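(* Let $j\in\mathbb{Z}$ and let $n$ be a one-dimensional real-valued, zero-mean, wide-sense stationary random process. (i) For all $(m,m')\in\{0,\ldots,M-1\}^2$ with $m=m'=0$ or $mm'\ne0$, we have $\gamma_{\psi_m^{\mathrm H},\psi_{m'}^{\mathrm H}}=\gamma_{\psi_m,\psi_{m'}}$ and, as a consequence, $\Gamma_{n_{j,m},n_{j,m'}}=\Gamma_{n^{\mathrm H}_{j,m},n^{\mathrm H}_{j,m'}}$. (ii) When $mm'\neq0$, we have $$\forall\tau\in\mathbb{R},\qquad \gamma_{\psi_m,\psi_{m'}^{\mathrm H}}(\tau)=-\gamma_{\psi_{m'},\psi_m^{\mathrm H}}(-\tau)$$ and, consequently, $$\forall\ell\in\mathbb{Z},\qquad \Gamma_{n_{j,m},n^{\mathrm H}_{j,m'}}[\ell]=-\Gamma_{n_{j,m'},n^{\mathrm H}_{j,m}}[-\ell].$$ (iii) The function $\gamma_{\psi_0,\psi_0^{\mathrm H}}$ is symmetric with respect to $-d-1/2$ (i.e. $\gamma_{\psi_0,\psi_0^{\mathrm H}}(\tau)=\gamma_{\psi_0,\psi_0^{\mathrm H}}(-\tau-2d-1)$ for all $\tau\in\mathbb{R}$), which entails that $\Gamma_{n_{j,0},n^{\mathrm H}_{j,0}}$ is symmetric with respect to $d+1/2$ (i.e. $\Gamma_{n_{j,0},n^{\mathrm H}_{j,0}}[\ell]=\Gamma_{n_{j,0},n^{\mathrm H}_{j,0}}[2d+1-\ell]$ for all $\ell\in\mathbb{Z}$).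
   Context: Fourier transform: $\widehat a(\omega)=\int a(t)e^{-\imath\omega t}dt$. $M\ge 2$ is an integer. $M$-band dual-tree wavelets: $\psi_0\in \mathrm L^2(\mathbb{R})$ is the (real-valued) scaling function and $\psi_1,\ldots,\psi_{M-1}\in \mathrm L^2(\mathbb{R})$ are the (real-valued) mother wavelets of an orthonormal $M$-band multiresolution analysis. They satisfy $\sqrt M\,\widehat\psi_m(M\omega)=H_m(\omega)\widehat\psi_0(\omega)$ for $m\in\{0,\ldots,M-1\}$, where the $H_m$ are $2\pi$-periodic frequency responses with $\sum_{p=0}^{M-1}H_m(\omega+\frac{2\pi p}{M})H_{m'}^*(\omega+\frac{2\pi p}{M})=M\delta_{m-m'}$; the functions $M^{-j/2}\psi_m(M^{-j}t-k)$, $1\le m\le M-1$, $j,k\in\mathbb{Z}$, form an orthonormal basis of $\mathrm L^2(\mathbb{R})$, and $\{\psi_m(\cdot-k): 0\le m\le M-1,\ k\in\mathbb{Z}\}$ is an orthonormal family. The dual functions $\psi_m^{\mathrm H}$ (real-valued, in $\mathrm L^2(\mathbb{R})$) are given by $\widehat\psi{}_m^{\mathrm H}(\omega)=-\imath\,\mathrm{sign}(\omega)\widehat\psi_m(\omega)$ for $m\ge1$ and, with $d$ a fixed integer, by $\widehat\psi{}_0^{\mathrm H}(\omega)=(-1)^k e^{-\imath(d+\frac12)\omega}\widehat\psi_0(\omega)$ if $\omega\in[2k\pi,2(k+1)\pi)$ with $k\ge0$, and $\widehat\psi{}_0^{\mathrm H}(\omega)=(-1)^{k+1} e^{-\imath(d+\frac12)\omega}\widehat\psi_0(\omega)$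 if $\omega\in[2k\pi,2(k+1)\pi)$ with $k<0$. Autocovariance: $\Gamma_n(\tau)=\mathsf{E}\{n(x+\tau)n(x)\}$ for all $\tau,x\in\mathbb{R}$. Deterministic cross-correlation of real-valued $f,g\in \mathrm L^2(\mathbb{R})$: $\gamma_{f,g}(\tau)=\int_{-\infty}^\infty f(x)g(x-\tau)\,dx$. Coefficients: $n_{j,m}[k]=\int n(x)M^{-j/2}\psi_m(M^{-j}x-k)\,dx$ and $n^{\mathrm H}_{j,m}[k]=\int n(x)M^{-j/2}\psi^{\mathrm H}_m(M^{-j}x-k)\,dx$. The symbol $\Gamma_{u,v}[\ell]$ denotes $\mathsf{E}\{u[k+\ell]v[k]\}$ (independent of $k$). It is assumed throughout that expectation and integrals may be exchanged (Fubini), i.e. $n$ is jointly measurable and $\int\int \mathsf{E}\{|n(x)n(x')|\}\,|f(M^{-j}x-k)|\,|g(M^{-j}x'-k')|\,dx\,dx'<\infty$ for all $f,g\in\{\psi_m,\psi_m^{\mathrm H}:0\le m\le M-1\}$, $k,k'\in\mathbb{Z}$, so that the covariance sequences are given by the absolutely convergent integrals $\Gamma_{n_{j,m},n_{j,m'}}[\ell]=\int\Gamma_n(x)\gamma_{\psi_m,\psi_{m'}}(M^{-j}x-\ell)dx$, $\Gamma_{n^{\mathrm H}_{j,m},n^{\mathrm H}_{j,m'}}[\ell]=\int\Gamma_n(x)\gamma_{\psi^{\mathrm H}_m,\psi^{\mathrm H}_{m'}}(M^{-j}x-\ell)dx$ and $\Gamma_{n_{j,m},n^{\mathrm H}_{j,m'}}[\ell]=\int\Gamma_n(x)\gamma_{\psi_m,\psi^{\mathrm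 H}_{m'}}(M^{-j}x-\ell)dx$. *)

(* Defs.v *)
From mathcomp Require Import all_boot all_order all_algebra.
From mathcomp Require Import all_classical all_reals all_analysis.
From mathcomp Require Export complex.

Set Implicit Arguments.
Unset Strict Implicit.
Unset Printing Implicit Defensive.

Import Order.TTheory GRing.Theory Num.Theory.
Import numFieldNormedType.Exports.

Local Open Scope classical_set_scope.
Local Open Scope ring_scope.
Local Open Scope complex_scope.

Section L2.
Context {R : realType}.
Let mu := @lebesgue_measure R.

Definition L2 (f : R -> R) : Prop := f \in Lfun mu 2%:E.

Definition cexp (theta : R) : R[i] := cos theta +i* sin theta.

Definition cintegral (A : set R) (g : R -> R[i]) : R[i] :=
  (\int[mu]_(t in A) complex.Re (g t)) +i*
  (\int[mu]_(t in A) complex.Im (g t)).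

Definition fourier_trunc (f : R -> R) (N : nat) (w : R) : R[i] :=
  cintegral `[- N%:R, N%:R] (fun t => (f t)%:C * cexp (- (w * t))).

(* F is a version of the L^2 (Plancherel) Fourier transform of f, with kernel
   e^{-iwt} and no normalizing factor: the transforms of the truncations of f
   to [-N, N] converge to F in L^2. Such an F is determined up to a Lebesgue
   null set. Measurability of F is required because the integral below is
   only a lower integral for non-measurable nonnegative functions. *)
Definition is_fourier (f : R -> R) (F : R -> R[i]) : Prop :=
  [/\ measurable_fun setT (fun w => complex.Re (F w)),
      measurable_fun setT (fun w => complex.Im (F w)) &
      (fun N => (\int[mu]_w
         ((Normc.normc (F w - fourier_trunc f N w)) ^+ 2)%:E)%E) @ \oo --> 0%E].

Definition crosscorr (f g : R -> R) (tau : R) : R :=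
  \int[mu]_x (f x * g (x - tau)).

Definition orthonormal_family (I : eqType) (A : set I) (e : I -> R -> R)
    : Prop :=
  (forall a, A a -> L2 (e a)) /\
  (forall a b, A a -> A b -> \int[mu]_x (e a x * e b x) = (a == b)%:R).

Definition orthonormal_basis (I : eqType) (A : set I) (e : I -> R -> R)
    : Prop :=
  orthonormal_family A e /\
  forall f, L2 f -> forall eps : R, 0 < eps ->
    exists (s : seq I) (c : I -> R), (forall a, a \in s -> A a) /\
      ('N[mu]_(2%:E)
         [EFin \o (fun x => f x - \sum_(a <- s) c a * e a x)%R] < eps%:E)%E.

End L2.

Section MBand.
Context {R : realType}.
Let mu := @lebesgue_measure R.

Definition dilate (M : nat) (j k : int) (f : R -> R) (x : R) : R :=
  M%:R `^ (- (j%:~R / 2)) * f ((M%:R : R) ^ (- j) * x - k%:~R).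

(* psi 0 is the scaling function, psi 1, ..., psi (M - 1) are the mother
   wavelets, psihat m is a version of the Fourier transform of psi m, and H m
   are the frequency responses; only the indices m < M are constrained.
   The approximation spaces V_j are the closed spans of the families
   (dilate M j k (psi 0))_k, and the usual axioms on (V_j)_j follow from the
   fields below. *)
Record mband_mra (M : nat) (psi : nat -> R -> R) (psihat H : nat -> R -> R[i])
    : Prop := MBandMRA {
  mra_L2 : forall m, (m < M)%N -> L2 (psi m);
  mra_fourier : forall m, (m < M)%N -> is_fourier (psi m) (psihat m);
  mra_periodic : forall m, (m < M)%N ->
    forall w, H m (w + 2 * pi) = H m w;
  mra_two_scale : forall m, (m < M)%N ->
    {ae mu, forall w, (Num.sqrt M%:R)%:C * psihat m (M%:R * w)
                      = H m w * psihat 0%N w};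
  mra_paraunitary : forall m m', (m < M)%N -> (m' < M)%N ->
    {ae mu, forall w,
      \sum_(p < M) H m (w + 2 * pi * p%:R / M%:R)
                   * conjc (H m' (w + 2 * pi * p%:R / M%:R))
      = M%:R * (m == m')%:R};
  mra_wavelet_basis :
    orthonormal_basis
      [set a : int * nat * int | (0 < a.1.2 < M)%N]
      (fun a => dilate M a.1.1 a.2 (psi a.1.2));
  mra_orthonormal :
    orthonormal_family
      [set a : nat * int | (a.1 < M)%N]
      (fun a x => psi a.1 (x - a.2%:~R))
}.

(* The index k is the integer with w in [2 k pi, 2 (k + 1) pi). *)
Definition dual_phase (d : int) (w : R) : R[i] :=
  let k := Num.floor (w / (2 * pi)) in
  (if (0 <= k)%R then (-1) ^ k else (-1) ^ (k + 1))
  * cexp (- ((d%:~R + 1 / 2) * w)).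

Record dual_mra (M : nat) (d : int) (psi : nat -> R -> R)
    (psihat : nat -> R -> R[i]) (psiH : nat -> R -> R) : Prop := DualMRA {
  dual_L2 : forall m, (m < M)%N -> L2 (psiH m);
  dual_wavelet : forall m, (0 < m < M)%N ->
    is_fourier (psiH m) (fun w => (0 -i* Num.sg w) * psihat m w);
  dual_scaling :
    is_fourier (psiH 0%N) (fun w => dual_phase d w * psihat 0%N w)
}.

Definition tree_functions (M : nat) (psi psiH : nat -> R -> R)
    : set (R -> R) :=
  [set f | exists2 m, (m < M)%N & f = psi m \/ f = psiH m].

End MBand.

Section Process.
Context {R : realType} {disp : measure_display} {T : measurableType disp}.
Variable P : probability T R.
Let mu := @lebesgue_measure R.

Definition zero_mean (n : R -> {RV P >-> R}) : Prop :=
  forall x, ('E_P[n x] = 0)%E.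

Definition wide_sense_stationary (n : R -> {RV P >-> R}) : Prop :=
  [/\ forall x, (n x : T -> R) \in Lfun P 2%:E,
      exists m : R, forall x, ('E_P[n x] = m%:E)%E &
      exists Gamma : R -> R, forall tau x,
        ('E_P[fun t => (n (x + tau)%R t * n x t)%R] = (Gamma tau)%:E)%E].

Definition jointly_measurable (n : R -> {RV P >-> R}) : Prop :=
  measurable_fun [set: measurableTypeR R * T] (fun z => n z.1 z.2).

Definition coef (n : R -> {RV P >-> R}) (M : nat) (f : R -> R) (j k : int)
    (t : T) : R :=
  \int[mu]_x (n x t * dilate M j k f x).

Definition fubini_condition (n : R -> {RV P >-> R}) (M : nat) (j : int)
    (S : set (R -> R)) : Prop :=
  jointly_measurable n /\
  forall f g, S f -> S g -> forall k k' : int,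
    (\int[mu]_x \int[mu]_x'
       ('E_P[fun t => `|n x t * n x' t|%R]
        * `|f ((M%:R : R) ^ (- j) * x - k%:~R)%R|%:E
        * `|g ((M%:R : R) ^ (- j) * x' - k'%:~R)%R|%:E) < +oo)%E.

(* E{u[k + l] v[k]}, as an extended real; its independence of k is not built
   in. *)
Definition xcov (u v : int -> T -> R) (k l : int) : \bar R :=
  ('E_P[fun t => (u (k + l) t * v k t)%R])%E.

End Process.

(* Main.v *)
Require Import Defs.
From mathcomp Require Import all_boot all_order all_algebra.
From mathcomp Require Import all_classical all_reals all_analysis.
From HB Require Import structures.
From mathcomp Require Import measurable_realfun.
From mathcomp Require Import ring lra.

Set Implicit Arguments.
Unset Strict Implicit.
Unset Printing Implicit Defensive.

Import Order.TTheory GRing.Theory Num.Theory.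
Import numFieldNormedType.Exports.

Local Open Scope classical_set_scope.
Local Open Scope ring_scope.

(** Parseval's identity reduces the three symmetries of the cross-correlations to
    identities between integrands. If F and G are the Fourier transforms of f and
    g, then [2 * pi * crosscorr f g tau] is the integral of the real part of
    [F w * conj (G w) * exp (i w tau)] ([parseval_crosscorr]). Passing to the dual
    functions multiplies F and G by factors that have modulus one almost
    everywhere. These cancel when both functions are replaced
    ([crosscorr_hilbert2], [crosscorr_dual_phase2]). When only one of them is, a
    factor remains: either [i sign (w)], and exchanging the roles of the two
    functions changes the sign of the real part ([crosscorr_hilbert]); or a sign
    times [exp (i (d + 1/2) w)], which leaves a cosine that is even in
    [tau + d + 1/2] ([crosscorr_dual_phase_sym]).

    For the coefficients, Fubini's theorem on the product of the probability space
    and the plane writes a covariance as the integral of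
    [Gamma (x - y) * u x * v y], where u and v are two dilated functions and Gamma
    is the autocovariance. Substituting [x = s + y] makes it the integral of
    [Gamma s * crosscorr u v s] ([expectation_mul_integrals]). So the covariances
    inherit the symmetries of the cross-correlations, because Gamma is even.

    Most of the work is in Parseval's identity, with the Fourier transform defined
    as an L2 limit over truncations.
    - For f and g both integrable and square-integrable, the integral of
      [F * conj G * exp (i w tau)] is damped by [expR (- (e * `|w|))]. By Fubini's
      theorem the damped integral is the integral of the cross-correlation
      against a Poisson kernel of mass [2 * pi]. The cross-correlation is bounded
      by the Cauchy-Schwarz inequality, and continuous because bounded continuous
      functions are dense in L2 ([sqint_density], [crosscorr_cvg]); hence the
      limit as e tends to 0 is [2 * pi * crosscorr f g tau]
      ([poisson_approx_identity]).
    - For f = g and tau = 0, monotone convergence shows that F is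
      square-integrable ([sqint_cosT_sinT]). Dominated convergence then removes
      the damping in general ([parseval_L1_L2]).
    - Truncations satisfy the previous assumptions, and products of sequences that
      converge in L2 have convergent integrals ([sqint_cvg_mul]), so the identity
      extends to all square-integrable functions. *)

(** * Affine changes of variable, Fubini and dominated convergence *)

Section affine.
Context {R : realType}.
Notation mu := (@lebesgue_measure R).
Implicit Types (f : R -> R) (a b : R).

Let aff a b : measurableTypeR R -> measurableTypeR R := fun x => a * x + b.

Let measurable_aff a b : measurable_fun setT (aff a b).
Proof.
by apply: measurable_funD => //; apply: measurable_funM.
Qed.

Lemma lebesgue_measure_affine a b (A : set (measurableTypeR R)) :
  a != 0 -> measurable A ->
  (`|a|%:E * pushforward mu (aff a b) A = mu A)%E.
Proof.
move=> a0 mA.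
have na0 : 0 <= `|a| by [].
apply/esym.
apply: (@lebesgue_measure_unique R
  (mscale (NngNum na0) (pushforward mu (aff a b)))) => //.
move=> _ [[u v]] _ <- /=.
rewrite /mscale/= /pushforward/=.
have [apos|aneg] : 0 < a \/ a < 0.
  by move: a0; rewrite neq_lt => /orP[]; [right|left].
- have -> : aff a b @^-1` `]u, v]%classic = `](u - b) / a, (v - b) / a]%classic.
    apply/seteqP; split => x; rewrite /= !in_itv/= /aff;
      by rewrite ltr_pdivrMr// ler_pdivlMr// ltrBlDr lerBrDr [x * a]mulrC.
  rewrite !lebesgue_measure_itv/= !lte_fin ltr_pM2r ?invr_gt0// ltrD2r.
  case: ifP => // _; last by rewrite mule0.
  by rewrite -!EFinD -EFinM gtr0_norm//; congr EFin; field.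
- have -> : aff a b @^-1` `]u, v]%classic = `[(v - b) / a, (u - b) / a[%classic.
    apply/seteqP; split => x; rewrite /= !in_itv/= /aff;
      by rewrite ler_ndivrMr// ltr_ndivlMr// ltrBlDr lerBrDr [x * a]mulrC andbC.
  rewrite !lebesgue_measure_itv/= !lte_fin ltr_nM2r ?invr_lt0// ltrD2r.
  case: ifP => // _; last by rewrite mule0.
  by rewrite -!EFinD -EFinM ltr0_norm//; congr EFin; field.
Qed.

Lemma ge0_integral_affine a b (f : R -> \bar R) : a != 0 ->
  measurable_fun setT f -> (forall x, 0 <= f x)%E ->
  (\int[mu]_x f (a * x + b)%R = (`|a|^-1)%:E * \int[mu]_x f x)%E.
Proof.
move=> a0 mf f0.
have na0 : 0 <= `|a| by [].
pose m : {measure set (measurableTypeR R) -> \bar R} :=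
  mscale (NngNum na0) (pushforward mu (aff a b)).
rewrite [X in (_ * X)%E](eq_measure_integral (m (measurable_aff a b))); last first.
  by move=> A mA _; rewrite /m/= /mscale/= lebesgue_measure_affine.
rewrite /m.
rewrite ge0_integral_mscale//=.
rewrite muleA -EFinM mulVf ?normr_eq0// mul1e.
rewrite ge0_integral_pushforward//=; exact: measurable_aff.
Qed.

Lemma integrable_affine a b f : a != 0 ->
  mu.-integrable setT (EFin \o f) ->
  mu.-integrable setT (EFin \o (fun x => f (a * x + b))).
Proof.
move=> a0 /integrableP[mf foo]; apply/integrableP; split.
  exact: (measurableT_comp mf (measurable_aff a b)).
rewrite (@ge0_integral_affine a b (fun x => `|(f x)%:E|%E))//.
  by rewrite lte_mul_pinfty// ?lee_fin ?invr_ge0.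
exact: measurableT_comp.
Qed.

Lemma Rintegral_affine a b f : a != 0 -> mu.-integrable setT (EFin \o f) ->
  \int[mu]_x f (a * x + b) = `|a|^-1 * \int[mu]_x f x.
Proof.
move=> a0 intf.
have na0 : 0 <= `|a| by [].
have mf : measurable_fun setT f.
  by case/integrableP : intf => /measurable_EFinP.
have intfp := integrable_funrpos measurableT intf.
have intfn := integrable_funrneg measurableT intf.
have fE x : f x = f^\+ x - f^\- x by rewrite -{1}(funrposBneg f).
under eq_Rintegral do rewrite fE.
under [in RHS]eq_Rintegral do rewrite fE.
rewrite RintegralB//; [|exact: (integrable_affine _ a0 intfp)
  |exact: (integrable_affine _ a0 intfn)].
rewrite (RintegralB _ intfp intfn)// mulrBr.
have key g : mu.-integrable setT (EFin \o g) -> (forall x, 0 <= g x) ->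
    \int[mu]_x g (a * x + b) = `|a|^-1 * \int[mu]_x g x.
  move=> ig g0; rewrite /Rintegral.
  rewrite (@ge0_integral_affine a b (fun x => (g x)%:E))//.
  - by rewrite fineM// ?integrable_fin_num.
  - by case/integrableP : ig.
by rewrite !key.
Qed.

Lemma integral_isometry a b (f : R -> \bar R) : `|a| = 1 ->
  measurable_fun setT f -> (\int[mu]_x f (a * x + b)%R = \int[mu]_x f x)%E.
Proof.
move=> a1 mf.
have a0 : a != 0 by rewrite -normr_eq0 a1 oner_neq0.
have key (g : R -> \bar R) : measurable_fun setT g -> (forall x, 0 <= g x)%E ->
    (\int[mu]_x g (a * x + b)%R = \int[mu]_x g x)%E.
  by move=> mg g0; rewrite ge0_integral_affine// a1 invr1 mul1e.
rewrite integralE [in RHS]integralE.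
rewrite -(key (funepos f))//; last exact: measurable_funepos.
rewrite -(key (funeneg f))//; last exact: measurable_funeneg.
congr (_ - _)%E.
  by apply: eq_integral => x _; rewrite !funeposE.
by apply: eq_integral => x _; rewrite !funenegE.
Qed.

Lemma Rintegral_shift b f : measurable_fun setT f ->
  \int[mu]_x f (x + b) = \int[mu]_x f x.
Proof.
move=> mf; rewrite /Rintegral; congr fine.
rewrite -(@integral_isometry 1 b (fun x => (f x)%:E)) ?normr1//; last first.
  exact/measurable_EFinP.
by apply: eq_integral => x _; rewrite mul1r.
Qed.

Lemma Rintegral_opp f : measurable_fun setT f ->
  \int[mu]_x f (- x) = \int[mu]_x f x.
Proof.
move=> mf; rewrite /Rintegral; congr fine.
rewrite -(@integral_isometry (-1) 0 (fun x => (f x)%:E)) ?normrN1//.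
  by apply: eq_integral => x _; rewrite mulN1r addr0.
exact/measurable_EFinP.
Qed.

Lemma integrable_shift b f : mu.-integrable setT (EFin \o f) ->
  mu.-integrable setT (EFin \o (fun x => f (x + b))).
Proof.
move=> intf; have := @integrable_affine 1 b f (oner_neq0 R) intf.
by apply: eq_integrable => // x _ /=; rewrite mul1r.
Qed.

End affine.

Section fubini_real1.
Context {R : realType} {d1 d2 : measure_display}.
Context {T1 : measurableType d1} {T2 : measurableType d2}.
Variable m1 : {sigma_finite_measure set T1 -> \bar R}.
Variable m2 : {sigma_finite_measure set T2 -> \bar R}.
Implicit Type F : T1 * T2 -> R.

Lemma measurable_Rintegral F : measurable_fun setT F ->
  measurable_fun setT (fun x => \int[m2]_y F (x, y)).
Proof.
move=> mF; rewrite (_ : (fun x => _) = fine \o (fun x =>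
    \int[m2]_y funepos (EFin \o F) (x, y) -
    \int[m2]_y funeneg (EFin \o F) (x, y))%E).
  apply: measurableT_comp => //; apply: emeasurable_funB;
    apply: measurable_fun_fubini_tonelli_F => //.
  - exact/measurable_funepos/measurable_EFinP.
  - exact/measurable_funeneg/measurable_EFinP.
apply/funext => x; rewrite /Rintegral /= integralE.
congr (fine (_ - _)); apply: eq_integral => y _.
- by rewrite !funeposE.
- by rewrite !funenegE.
Qed.

(** The inner integrals are finite only almost everywhere; the real-valued
    integral gives the value 0 to the others, on a negligible set. *)
Lemma Rintegral12 F : (m1 \x m2)%E.-integrable setT (EFin \o F) ->
  m1.-integrable setT (EFin \o (fun x => \int[m2]_y F (x, y))) /\
  \int[m1]_x (\int[m2]_y F (x, y)) = \int[(m1 \x m2)%E]_z F z.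
Proof.
move=> intF.
have intF1 := integrable_fubini_F intF.
have finF : {ae m1, forall x, fubini_F m2 (EFin \o F) x \is a fin_num}.
  have := integrable_ae measurableT intF1.
  by apply: filterS => x /(_ I).
have mF1 := measurable_int m1 intF1.
have mR : measurable_fun setT (EFin \o (fun x => \int[m2]_y F (x, y))).
  apply/measurable_EFinP/measurable_Rintegral.
  by apply/measurable_EFinP; exact: measurable_int intF.
have aeE : ae_eq m1 setT (fubini_F m2 (EFin \o F))
    (EFin \o (fun x => \int[m2]_y F (x, y))).
  by apply: filterS finF => x fx _; rewrite /= /Rintegral fineK.
split.
  apply/integrableP; split => //.
  have /integrableP[_] := intF1; apply: le_lt_trans.
  rewrite le_eqVlt; apply/orP; left; apply/eqP.
  apply: ae_eq_integral => //.
  - exact: measurableT_comp.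
  - exact: measurableT_comp.
  - by apply: filterS aeE => x /(_ I) ->.
rewrite [LHS]/Rintegral [RHS]/Rintegral -(integral12_prod_meas1 intF).
congr fine; apply: ae_eq_integral => //.
by apply: filterS aeE => x /(_ I) ->.
Qed.

End fubini_real1.

Section fubini_real2.
Context {R : realType} {d1 d2 : measure_display}.
Context {T1 : measurableType d1} {T2 : measurableType d2}.
Variable m1 : {sigma_finite_measure set T1 -> \bar R}.
Variable m2 : {sigma_finite_measure set T2 -> \bar R}.
Implicit Type F : T1 * T2 -> R.

Lemma Rintegral21 F : (m1 \x m2)%E.-integrable setT (EFin \o F) ->
  m2.-integrable setT (EFin \o (fun y => \int[m1]_x F (x, y))) /\
  \int[m2]_y (\int[m1]_x F (x, y)) = \int[(m1 \x m2)%E]_z F z.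
Proof.
move=> intF.
have mF : measurable_fun setT (EFin \o F) by exact: measurable_int intF.
have mS : measurable_fun setT (EFin \o (F \o (fun z : T2 * T1 => (z.2, z.1)))).
  apply: (measurableT_comp mF); exact: measurable_fun_pair.
have intS : (m2 \x m1)%E.-integrable setT
    (EFin \o (F \o (fun z : T2 * T1 => (z.2, z.1)))).
  by apply/integrable12ltyP => //; exact: (integrable21ltyP m1 m2 mF).1 intF.
have [iS eS] := Rintegral12 intS; split => //; rewrite [LHS]eS.
rewrite /Rintegral -(integral21_prod_meas1 intF).
by rewrite -(integral12_prod_meas1 intS).
Qed.

Lemma integrable_prodM (f : T1 -> R) (g : T2 -> R) :
  m1.-integrable setT (EFin \o f) -> m2.-integrable setT (EFin \o g) ->
  (m1 \x m2)%E.-integrable setT (EFin \o (fun z => f z.1 * g z.2)).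
Proof.
move=> /integrableP[/measurable_EFinP mf fi] /integrableP[/measurable_EFinP mg gi].
have mfg : measurable_fun setT (fun z : T1 * T2 => f z.1 * g z.2).
  by apply: measurable_funM; apply: measurableT_comp.
apply/integrable12ltyP; first exact/measurable_EFinP.
have -> : (\int[m1]_x \int[m2]_y `|(EFin \o (fun z => f z.1 * g z.2)%R) (x, y)| =
    \int[m1]_x (`|(f x)%:E| * \int[m2]_y `|(g y)%:E|))%E.
  apply: eq_integral => x _.
  rewrite -ge0_integralZl//=.
    by apply: eq_integral => y _; rewrite -EFinM normrM.
  exact/measurable_EFinP/measurableT_comp.
rewrite ge0_integralZr//.
- by rewrite lte_mul_pinfty// ?ge0_fin_numE// ?integral_ge0.
- exact/measurable_EFinP/measurableT_comp.
- exact: integral_ge0.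
Qed.

Lemma Rintegral_prodM (f : T1 -> R) (g : T2 -> R) :
  m1.-integrable setT (EFin \o f) -> m2.-integrable setT (EFin \o g) ->
  \int[(m1 \x m2)%E]_z (f z.1 * g z.2) =
  \int[m1]_x f x * \int[m2]_y g y.
Proof.
move=> fi gi; have [_ <-] := Rintegral12 (integrable_prodM fi gi).
rewrite -RintegralZr//; apply: eq_Rintegral => x _.
by rewrite -RintegralZl.
Qed.

End fubini_real2.

Lemma Rintegral_dominated_cvg {R : realType} {d : measure_display}
    {T : measurableType d} (mu : {measure set T -> \bar R})
    (f_ : nat -> T -> R) (f g : T -> R) :
  (forall n, measurable_fun setT (f_ n)) -> measurable_fun setT f ->
  (forall x, f_ n x @[n --> \oo] --> f x) ->
  mu.-integrable setT (EFin \o g) -> (forall n x, `|f_ n x| <= g x) ->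
  \int[mu]_x f_ n x @[n --> \oo] --> \int[mu]_x f x.
Proof.
move=> mf_ mf cf ig fg.
have [ifi _ cvgI] : [/\ mu.-integrable setT (EFin \o f),
    [sequence \int[mu]_x `|(f_ n x)%:E - (f x)%:E|]_n @ \oo --> 0 &
    [sequence \int[mu]_x (f_ n x)%:E]_n @ \oo --> \int[mu]_x (f x)%:E]%E.
  apply: (@dominated_convergence _ T R mu setT measurableT
    (fun n => EFin \o f_ n) (EFin \o f) (EFin \o g)) => //.
  - by move=> n; exact/measurable_EFinP.
  - exact/measurable_EFinP.
  - by apply: aeW => x _; apply: cvg_EFin; [exact: nearW|exact: cf].
  - by apply: aeW => x n _; rewrite lee_fin.
rewrite /Rintegral; apply: fine_cvg.
by rewrite fineK ?integrable_fin_num.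
Qed.

(** * Square-integrable functions *)

Section sqint.
Context {R : realType} {d : measure_display} {T : measurableType d}.
Variable mu : {measure set T -> \bar R}.
Implicit Types f g : T -> R.

Definition sqint f := measurable_fun setT f /\
  mu.-integrable setT (EFin \o (fun x => f x ^+ 2)).

Lemma le_sqint f g : measurable_fun setT f -> sqint g ->
  (forall x, `|f x| <= `|g x|) -> sqint f.
Proof.
move=> mf [mg g2] fg; split => //.
apply: le_integrable g2 => //.
- exact/measurable_EFinP/measurable_funX.
- move=> x _; rewrite /= lee_fin !normrX.
  by rewrite lerXn2r// nnegrE.
Qed.

Lemma sqint_mul_integrable f g : sqint f -> sqint g ->
  mu.-integrable setT (EFin \o (fun x => f x * g x)).
Proof.
move=> [mf f2] [mg g2].
apply: (le_integrable measurableT _ _ (integrableD measurableT f2 g2)).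
  exact/measurable_EFinP/measurable_funM.
move=> x _; rewrite /= lee_fin normrM.
rewrite [leRHS]ger0_norm ?addr_ge0 ?sqr_ge0//.
rewrite -[f x ^+ 2]real_normK ?num_real// -[g x ^+ 2]real_normK ?num_real//.
by move: `|f x| `|g x| => u v; nra.
Qed.

Lemma sqintD f g : sqint f -> sqint g -> sqint (fun x => f x + g x).
Proof.
move=> [mf f2] [mg g2]; split; first exact: measurable_funD.
have i2 := integrableD measurableT (integrableZl measurableT 2 f2)
  (integrableZl measurableT 2 g2).
apply: (le_integrable measurableT _ _ i2).
  exact/measurable_EFinP/measurable_funX/measurable_funD.
move=> x _; rewrite /= lee_fin.
move: (f x) (g x) => u v.
rewrite ger0_norm ?sqr_ge0// (le_trans _ (ler_norm _))//.
by have := sqr_ge0 (u - v); nra.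
Qed.

Lemma sqintZ c f : sqint f -> sqint (fun x => c * f x).
Proof.
move=> [mf f2]; split; first exact: measurable_funM.
have i2 := integrableZl measurableT (c ^+ 2) f2.
by apply: eq_integrable i2 => // x _ /=; rewrite exprMn.
Qed.

Lemma sqintB f g : sqint f -> sqint g -> sqint (fun x => f x - g x).
Proof.
move=> sf sg; have := sqintD sf (sqintZ (-1) sg).
by under eq_fun do rewrite mulN1r.
Qed.

Lemma cauchy_schwarz f g : sqint f -> sqint g ->
  (\int[mu]_x (f x * g x)) ^+ 2 <=
  (\int[mu]_x (f x ^+ 2)) * (\int[mu]_x (g x ^+ 2)).
Proof.
move=> sf sg; have ifg := sqint_mul_integrable sf sg.
have [_ f2] := sf; have [_ g2] := sg.
set A := \int[mu]_x (f x ^+ 2); set B := \int[mu]_x (g x ^+ 2).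
set C := \int[mu]_x (f x * g x).
have quad t : 0 <= A + 2 * t * C + t ^+ 2 * B.
  have ic := integrableZl measurableT (2 * t) ifg.
  have ib := integrableZl measurableT (t ^+ 2) g2.
  have iac := integrableD measurableT f2 ic.
  have -> : A + 2 * t * C + t ^+ 2 * B = \int[mu]_x ((f x + t * g x) ^+ 2).
    rewrite /C /B -(RintegralZl (2 * t) measurableT ifg).
    rewrite -(RintegralZl (t ^+ 2) measurableT g2).
    rewrite -(RintegralD measurableT f2 ic) -(RintegralD measurableT iac ib).
    by apply: eq_Rintegral => x _; ring.
  by apply: Rintegral_ge0 => x _; exact: sqr_ge0.
(* The quadratic polynomial of t is nonnegative: take its value at its
   minimum - C / B, or, if it is affine, where it would be - 1. *)
have B0 : 0 <= B by apply: Rintegral_ge0 => x _; exact: sqr_ge0.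
have [B00|Bn0] := eqVneq B 0.
  rewrite B00 mulr0.
  have [->|C0] := eqVneq C 0; first by rewrite expr0n.
  have := quad (- (A + 1) / (2 * C)); rewrite B00.
  have -> : 2 * (- (A + 1) / (2 * C)) * C = - (A + 1) by field.
  by rewrite mulr0 addr0; lra.
have Bp : 0 < B by rewrite lt_neqAle eq_sym Bn0.
have := quad (- C / B).
have -> : A + 2 * (- C / B) * C + (- C / B) ^+ 2 * B = A - C ^+ 2 / B by field.
by rewrite subr_ge0 ler_pdivrMr.
Qed.

Lemma normr_Rintegral_mul f g : sqint f -> sqint g ->
  `|\int[mu]_x (f x * g x)| <=
  Num.sqrt (\int[mu]_x (f x ^+ 2)) * Num.sqrt (\int[mu]_x (g x ^+ 2)).
Proof.
move=> sf sg; rewrite -sqrtrM; last first.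
  by apply: Rintegral_ge0 => x _; exact: sqr_ge0.
by rewrite -sqrtr_sqr ler_wsqrtr// cauchy_schwarz.
Qed.

(** By Cauchy-Schwarz, since
    [f_ g_ - f g = (f_ - f) (g_ - g) + f (g_ - g) + (f_ - f) g]. *)
Lemma sqint_cvg_mul (f_ g_ : nat -> T -> R) f g :
  (forall n, sqint (f_ n)) -> (forall n, sqint (g_ n)) -> sqint f -> sqint g ->
  \int[mu]_x ((f_ n x - f x) ^+ 2) @[n --> \oo] --> 0 ->
  \int[mu]_x ((g_ n x - g x) ^+ 2) @[n --> \oo] --> 0 ->
  \int[mu]_x (f_ n x * g_ n x) @[n --> \oo] --> \int[mu]_x (f x * g x).
Proof.
move=> sf_ sg_ sf sg cf cg.
have csqrt (u : nat -> R) : u n @[n --> \oo] --> 0 ->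
    Num.sqrt (u n) @[n --> \oo] --> 0.
  by move=> cu; rewrite -(@sqrtr0 R); apply: (cvg_comp _ _ cu); exact: sqrt_continuous.
have c0 (a_ b_ : nat -> T -> R) : (forall n, sqint (a_ n)) ->
    (forall n, sqint (b_ n)) ->
    Num.sqrt (\int[mu]_x (a_ n x ^+ 2)) *
      Num.sqrt (\int[mu]_x (b_ n x ^+ 2)) @[n --> \oo] --> 0 ->
    \int[mu]_x (a_ n x * b_ n x) @[n --> \oo] --> 0.
  move=> sa sb cab; apply/norm_cvg0P.
  apply: (squeeze_cvgr _ (cvg_cst 0) cab).
  by apply: nearW => n; rewrite normr_ge0 normr_Rintegral_mul.
have sfB n : sqint (fun x => f_ n x - f x) by exact: sqintB.
have sgB n : sqint (fun x => g_ n x - g x) by exact: sqintB.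
have e1 : \int[mu]_x ((f_ n x - f x) * (g_ n x - g x)) @[n --> \oo] --> 0.
  apply: (c0 (fun n x => f_ n x - f x) (fun n x => g_ n x - g x)) => //.
  rewrite -(mulr0 0).
  by apply: cvgM; exact: csqrt.
have e2 : \int[mu]_x (f x * (g_ n x - g x)) @[n --> \oo] --> 0.
  apply: (c0 (fun n x => f x) (fun n x => g_ n x - g x)) => //.
  rewrite -(mulr0 (Num.sqrt (\int[mu]_x (f x ^+ 2)))).
  by apply: cvgM; [exact: cvg_cst|exact: csqrt].
have e3 : \int[mu]_x ((f_ n x - f x) * g x) @[n --> \oo] --> 0.
  apply: (c0 (fun n x => f_ n x - f x) (fun n x => g x)) => //.
  rewrite -(mul0r (Num.sqrt (\int[mu]_x (g x ^+ 2)))).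
  by apply: cvgM; [exact: csqrt|exact: cvg_cst].
have -> : (fun n => \int[mu]_x (f_ n x * g_ n x)) =
    (fun n => \int[mu]_x ((f_ n x - f x) * (g_ n x - g x)) +
       \int[mu]_x (f x * (g_ n x - g x)) +
       \int[mu]_x ((f_ n x - f x) * g x) + \int[mu]_x (f x * g x)).
  apply/funext => n.
  have i1 := sqint_mul_integrable (sfB n) (sgB n).
  have i2 := sqint_mul_integrable sf (sgB n).
  have i3 := sqint_mul_integrable (sfB n) sg.
  have i12 := integrableD measurableT i1 i2.
  have i123 := integrableD measurableT i12 i3.
  rewrite -(RintegralD measurableT i1 i2) -(RintegralD measurableT i12 i3).
  rewrite -(RintegralD measurableT i123 (sqint_mul_integrable sf sg)).
  by apply: eq_Rintegral => x _; ring.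
have := cvgD (cvgD (cvgD e1 e2) e3) (cvg_cst (\int[mu]_x (f x * g x))).
by rewrite !add0r; apply.
Qed.

End sqint.

(** * Density of bounded continuous functions *)

Section clip.
Context {R : realType}.
Implicit Types (b x y : R).

Definition clip b x : R := Num.max (- b) (Num.min b x).

Lemma clip_lipschitz b x y : `|clip b x - clip b y| <= `|x - y|.
Proof.
have := ler_norm (x - y); have := ler_norm (y - x); rewrite [`|y - x|]distrC.
move: `|x - y| => r ? ?; rewrite ler_norml /clip /Num.min.
do 2 (case: ifPn; rewrite -?leNgt => ?); rewrite /Num.max;
  do ?(case: ifPn; rewrite -?leNgt => ?); apply/andP; split; lra.
Qed.

Lemma norm_clip b x : 0 <= b -> `|clip b x| <= b.
Proof.
move=> b0; rewrite ler_norml /clip /Num.min.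
case: ifPn; rewrite -?leNgt => ?; rewrite /Num.max;
  case: ifPn; rewrite -?leNgt => ?; apply/andP; split; lra.
Qed.

Lemma clip_id b x : `|x| <= b -> clip b x = x.
Proof.
rewrite ler_norml /clip /Num.min => /andP[? ?].
case: ifPn; rewrite -?leNgt => ?; rewrite /Num.max;
  case: ifPn; rewrite -?leNgt => ?; lra.
Qed.

Lemma clip0 b : 0 <= b -> clip b 0 = 0.
Proof. by move=> b0; rewrite clip_id ?normr0. Qed.

Lemma continuous_clip b : continuous (clip b).
Proof.
move=> x.
apply: (@continuous_max _ _ (fun=> - b) (fun y => Num.min b y) x).
  exact: cst_continuous.
apply: (@continuous_min _ _ (fun=> b) id x); [exact: cst_continuous|].
exact: cvg_id.
Qed.

End clip.

Section density.
Context {R : realType}.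
Notation mu := (@lebesgue_measure R).
Implicit Types (f g h : R -> R) (b x : R).

Definition cutoff b x : R := Num.max 0 (Num.min 1 (b + 1 - `|x|)).

Let cutoff_itv b x : 0 <= cutoff b x <= 1.
Proof.
rewrite /cutoff /Num.min; case: ifPn; rewrite -?leNgt => ?;
  rewrite /Num.max; case: ifPn; rewrite -?leNgt => ?; apply/andP; split; lra.
Qed.

Let cutoff1 b x : `|x| <= b -> cutoff b x = 1.
Proof.
move=> ?; rewrite /cutoff /Num.min; case: ifPn; rewrite -?leNgt => ?;
  rewrite /Num.max; case: ifPn; rewrite -?leNgt => ?; lra.
Qed.

Let cutoff0 b x : b + 1 < `|x| -> cutoff b x = 0.
Proof.
move=> ?; rewrite /cutoff /Num.min; case: ifPn; rewrite -?leNgt => ?;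
  rewrite /Num.max; case: ifPn; rewrite -?leNgt => ?; lra.
Qed.

Let continuous_cutoff b : continuous (cutoff b).
Proof.
move=> x.
apply: (@continuous_max _ _ (fun=> 0) (fun y => Num.min 1 (b + 1 - `|y|)) x).
  exact: cst_continuous.
apply: (@continuous_min _ _ (fun=> 1) (fun y => b + 1 - `|y|) x).
  exact: cst_continuous.
apply: cvgB; first exact: cvg_cst.
exact: norm_continuous.
Qed.

Lemma sqint_indic_itv (u v : R) : sqint mu (\1_`[u, v] : R -> R).
Proof.
split; first exact: measurable_indic.
have := integrable_indic_itv u v true false.
apply: eq_integrable => // x _ /=.
by rewrite indicE; case: (_ \in _); rewrite ?expr1n ?expr0n.
Qed.

Lemma sqint_bounded_supp b f : measurable_fun setT f ->
  (forall x, `|f x| <= b) -> (forall x, b < `|x| -> f x = 0) -> sqint mu f.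
Proof.
move=> mf fb f0.
have b0 : 0 <= b by apply: le_trans (fb 0).
apply: (le_sqint _ (sqintZ b (sqint_indic_itv (- b) b))) => // x.
have [xb|xb] := lerP `|x| b; last by rewrite f0// normr0.
rewrite indicE mem_set ?mulr1 ?(ger0_norm b0)//=.
by rewrite in_itv/= -ler_norml.
Qed.

(** Continuous functions approximate in L1 on a segment; clipping and cutting
    off such an approximant brings it closer to a bounded function of bounded
    support, and turns L1-closeness into L2-closeness. *)
Lemma continuous_approx_bounded_supp b f e : 0 <= b -> 0 < e ->
  measurable_fun setT f ->
  (forall x, `|f x| <= b) -> (forall x, b < `|x| -> f x = 0) ->
  exists h, [/\ continuous h, forall x, `|h x| <= b, sqint mu h &
    \int[mu]_x ((h x - f x) ^+ 2) <= e].
Proof.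
move=> b0 e0 mf fb f0.
pose E := `[- (b + 1), b + 1]%classic.
have mE : measurable (E : set (measurableTypeR R)) by exact: measurable_itv.
have Efin : (mu E < +oo)%E.
  by rewrite lebesgue_measure_itv/=; case: ifP => // _; rewrite -EFinD ltry.
have fE : mu.-integrable E (EFin \o f).
  apply: measurable_bounded_integrable => //; first exact: measurable_funTS.
  by exists b; split; rewrite ?num_real// => M bM x _; exact: le_trans (fb x) (ltW bM).
have [phi_ [cphi iphi /fine_cvgP[_ /cvgrPdist_lt cvphi]]] :=
  approximation_continuous_integrable mE Efin fE.
pose delta := e / (2 * b + 1).
have d0 : 0 < delta by rewrite divr_gt0//; lra.
have [N _ /(_ N (leqnn N))/=] := cvphi _ d0.
move: (phi_ N) (cphi N) (iphi N) => phi {}cphi {}iphi.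
rewrite sub0r normrN => lt_d.
have {lt_d} lt_d : \int[mu]_(x in E) `|f x - phi x| < delta.
  exact: le_lt_trans (ler_norm _) lt_d.
pose h x := clip b (phi x) * cutoff b x.
have ch : continuous h.
  move=> x; apply: cvgM; last exact: continuous_cutoff.
  exact: (@cvg_comp _ _ _ phi (clip b) _ _ _ (cphi x) (@continuous_clip R b (phi x))).
have hb x : `|h x| <= b.
  have /andP[? ?] := cutoff_itv b x.
  rewrite normrM [`|cutoff _ _|]ger0_norm//.
  by apply: le_trans (norm_clip (phi x) b0); rewrite ler_piMr.
have mh : measurable_fun setT h by exact: continuous_measurable_fun.
have h0 x : b + 1 < `|x| -> h x = 0.
  by move=> bx; rewrite /h cutoff0// mulr0.
have sh : sqint mu h.
  apply: (@sqint_bounded_supp (b + 1)) => // x.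
  by rewrite (le_trans (hb x))// lerDl.
exists h; split => //.
have sf : sqint mu f by exact: sqint_bounded_supp fb f0.
have [_ i2] := sqintB sh sf.
have iE : mu.-integrable E (EFin \o (fun x => `|f x - phi x|)).
  apply: (@integrable_norm _ _ _ mu E (fun x => f x - phi x)).
  exact: (integrableB mE fE iphi).
have iT : mu.-integrable setT
    (EFin \o ((fun x => `|f x - phi x|) \_ E)).
  by rewrite -restrict_EFin; apply/(integrable_mkcond _ mE).
have hf x : `|h x - f x| <= ((fun x => `|f x - phi x|) \_ E) x.
  rewrite patchE; case: ifPn => [|/negP xE].
    rewrite /E inE/= in_itv/= -ler_norml => xb1.
    have [xb|xb] := lerP `|x| b.
      rewrite /h cutoff1// mulr1 distrC.
      by have := clip_lipschitz b (f x) (phi x); rewrite (clip_id (fb x)).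
    have /andP[? ?] := cutoff_itv b x.
    rewrite f0// subr0 sub0r normrN /h normrM [`|cutoff _ _|]ger0_norm//.
    apply: (@le_trans _ _ `|clip b (phi x)|); first by rewrite ler_piMr.
    by have := clip_lipschitz b (phi x) 0; rewrite clip0// !subr0.
  have xb1 : b + 1 < `|x|.
    rewrite ltNge; apply/negP => xb1; apply: xE.
    by rewrite /E inE/= in_itv/= -ler_norml.
  by rewrite h0// f0 ?subrr ?normr0// (lt_trans _ xb1)// ltrDl.
apply: (@le_trans _ _ (\int[mu]_x (2 * b *
    ((fun x => `|f x - phi x|) \_ E) x))).
  apply: le_Rintegral => //; first exact: (integrableZl _ _ iT).
  move=> x _; rewrite -real_normK ?num_real// expr2.
  apply: ler_pM => //.
  by rewrite (le_trans (ler_normB _ _))//; have := hb x; have := fb x; lra.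
rewrite RintegralZl// -Rintegral_mkcond.
apply: (@le_trans _ _ (2 * b * delta)).
  by apply: ler_wpM2l; [lra|exact: ltW].
rewrite /delta mulrA ler_pdivrMr; last by lra.
by nra.
Qed.

(** Clip f to [[- n, n]], cut it off outside of the segment [[- n, n]], and
    apply [continuous_approx_bounded_supp]. *)
Lemma sqint_density f : sqint mu f ->
  exists h_ : nat -> R -> R, [/\ forall n, continuous (h_ n),
    forall n, exists b, forall x, `|h_ n x| <= b,
    forall n, sqint mu (h_ n) &
    \int[mu]_x ((h_ n x - f x) ^+ 2) @[n --> \oo] --> 0].
Proof.
move=> sf; have [mf f2] := sf.
pose f_ n x := clip n%:R (f x) * \1_`[- n%:R, n%:R] x : R.
have mf_ n : measurable_fun setT (f_ n).
  apply: measurable_funM; last exact: measurable_indic.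
  apply: (@measurableT_comp _ _ _ _ _ _ (clip n%:R)) => //.
  exact: continuous_measurable_fun (@continuous_clip R n%:R).
have f_b n x : `|f_ n x| <= n%:R.
  rewrite /f_ indicE; case: (_ \in _); rewrite ?mulr1 ?mulr0 ?normr0//.
  exact: norm_clip.
have f_0 n x : n%:R < `|x| -> f_ n x = 0.
  move=> nx; rewrite /f_ indicE memNset ?mulr0//= in_itv/= -ler_norml.
  by apply/negP; rewrite -ltNge.
have sf_ n : sqint mu (f_ n) by exact: sqint_bounded_supp (f_b n) (f_0 n).
have f_cvg : \int[mu]_x ((f_ n x - f x) ^+ 2) @[n --> \oo] --> 0.
  rewrite (_ : 0 = Rintegral mu setT (fun=> 0)); last first.
    by rewrite Rintegral_cst// mul0r.
  apply: (@Rintegral_dominated_cvg _ _ _ mu (fun n x => (f_ n x - f x) ^+ 2)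
    (fun=> 0) (fun x => f x ^+ 2)) => //.
  - by move=> n; apply: measurable_funX; have [] := sqintB (sf_ n) sf.
  - move=> x; apply: cvg_near_cst.
    near=> n.
    have nx : `|x| <= n%:R by near: n; exact: nbhs_infty_ger.
    have nf : `|f x| <= n%:R by near: n; exact: nbhs_infty_ger.
    rewrite /f_ indicE mem_set/= ?in_itv/= -?ler_norml// mulr1 clip_id//.
    by rewrite subrr expr0n.
  - move=> n x; rewrite ger0_norm ?sqr_ge0//.
    rewrite /f_ indicE; case: (_ \in _); rewrite ?mulr1 ?mulr0; last first.
      by rewrite sub0r sqrrN.
    have := f x; rewrite /clip /Num.min => y.
    have n0 : 0 <= n%:R :> R by [].
    move: (n%:R : R) n0 => t t0.
    case: ifPn; rewrite -?leNgt => ?;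
      rewrite /Num.max; case: ifPn; rewrite -?leNgt => ?; nra.
have hn n : exists h, [/\ continuous h, forall x, `|h x| <= n%:R, sqint mu h &
    \int[mu]_x ((h x - f_ n x) ^+ 2) <= n.+1%:R^-1].
  by apply: continuous_approx_bounded_supp => //; exact: f_0.
pose h_ n := projT1 (cid (hn n)).
have h_P n := projT2 (cid (hn n)).
have sh_ n : sqint mu (h_ n) by have [] := h_P n.
exists h_; split => //.
- by move=> n; have [] := h_P n.
- by move=> n; exists n%:R; have [] := h_P n.
have ub : 2 * n.+1%:R^-1 + 2 * \int[mu]_x ((f_ n x - f x) ^+ 2) @[n --> \oo]
    --> (2 * 0 + 2 * 0 : R).
  apply: cvgD; apply: cvgM => //; first exact: cvg_cst.
    exact: cvg_harmonic.
  exact: cvg_cst.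
rewrite mulr0 addr0 in ub.
apply: (squeeze_cvgr _ (cvg_cst 0) ub).
apply: nearW => n; rewrite Rintegral_ge0//=; last by move=> x _; exact: sqr_ge0.
have [_ _ _ le1] := h_P n.
have [_ i1] := sqintB (sh_ n) (sf_ n).
have [_ i2] := sqintB (sf_ n) sf.
have [_ i3] := sqintB (sh_ n) sf.
apply: (@le_trans _ _ (2 * \int[mu]_x ((h_ n x - f_ n x) ^+ 2) +
    2 * \int[mu]_x ((f_ n x - f x) ^+ 2))); last first.
  by rewrite lerD2r ler_wpM2l.
have j1 := integrableZl measurableT 2 i1.
have j2 := integrableZl measurableT 2 i2.
rewrite -(RintegralZl 2 measurableT i1) -(RintegralZl 2 measurableT i2).
rewrite -(RintegralD measurableT j1 j2).
apply: le_Rintegral => //; first exact: (integrableD measurableT j1 j2).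
move=> x _; move: (h_ n x) (f_ n x) (f x) => u v w.
by have := sqr_ge0 ((u - v) - (v - w)); nra.
Unshelve. all: by end_near. Qed.

End density.


(** * Continuity of the cross-correlation *)

Section crosscorr_theory.
Context {R : realType}.
Notation mu := (@lebesgue_measure R).
Implicit Types (f g h : R -> R) (s tau : R).

Lemma sqint_shift s f : sqint mu f -> sqint mu (fun x => f (x + s)).
Proof.
move=> [mf f2]; split; last exact: (integrable_shift s f2).
by apply: measurableT_comp mf _; exact: measurable_funD.
Qed.

Lemma crosscorrE f g s : measurable_fun setT f -> measurable_fun setT g ->
  crosscorr f g s = \int[mu]_x (f (x + s) * g x).
Proof.
move=> mf mg.
rewrite -(@Rintegral_shift R (- s) (fun x => f (x + s) * g x)).
  by apply: eq_Rintegral => x _; rewrite subrK.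
by apply: measurable_funM => //; apply: measurableT_comp mf _; exact: measurable_funD.
Qed.

Lemma norm_crosscorr_le f g s : sqint mu f -> sqint mu g ->
  `|crosscorr f g s| <= Num.sqrt (\int[mu]_x (f x ^+ 2)) *
                       Num.sqrt (\int[mu]_x (g x ^+ 2)).
Proof.
move=> sf sg; have [mf f2] := sf; have [mg _] := sg.
rewrite crosscorrE//.
rewrite -(@Rintegral_shift R s (fun x => f x ^+ 2)); last exact: measurable_funX.
exact: (normr_Rintegral_mul (sqint_shift s sf) sg).
Qed.

(** The bound above is uniform in the shift, so that it is enough to treat
    bounded continuous f, by dominated convergence. *)
Lemma crosscorr_cvg f g (s_ : nat -> R) tau : sqint mu f -> sqint mu g ->
  mu.-integrable setT (EFin \o g) -> s_ n @[n --> \oo] --> tau ->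
  crosscorr f g (s_ n) @[n --> \oo] --> crosscorr f g tau.
Proof.
move=> sf sg ig cs; have [mf f2] := sf; have [mg g2] := sg.
have [h_ [ch hb sh ch0]] := sqint_density sf.
have diff k s : `|crosscorr f g s - crosscorr (h_ k) g s| <=
    Num.sqrt (\int[mu]_x ((h_ k x - f x) ^+ 2)) *
    Num.sqrt (\int[mu]_x (g x ^+ 2)).
  have [mh _] := sh k.
  have -> : crosscorr f g s - crosscorr (h_ k) g s =
      - crosscorr (fun x => h_ k x - f x) g s.
    rewrite !crosscorrE//; last exact: measurable_funB.
    rewrite -RintegralB//; first last.
    - exact: (sqint_mul_integrable (sqint_shift s (sh k)) sg).
    - exact: (sqint_mul_integrable (sqint_shift s sf) sg).
    rewrite -mulN1r -RintegralZl//; last first.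
      exact: (sqint_mul_integrable (sqint_shift s (sqintB (sh k) sf)) sg).
    by apply: eq_Rintegral => x _; ring.
  by rewrite normrN; exact: (norm_crosscorr_le s (sqintB (sh k) sf) sg).
apply/cvgrPdist_le => e e0.
have e30 : 0 < e / 3 by rewrite divr_gt0.
have c0 : Num.sqrt (\int[mu]_x ((h_ k x - f x) ^+ 2)) *
    Num.sqrt (\int[mu]_x (g x ^+ 2)) @[k --> \oo] --> 0.
  rewrite -(mul0r (Num.sqrt (\int[mu]_x (g x ^+ 2)))).
  apply: cvgM; last exact: cvg_cst.
  by rewrite -(@sqrtr0 R); apply: (cvg_comp _ _ ch0); exact: sqrt_continuous.
have /cvgrPdist_le/(_ _ e30)[k _ /(_ k (leqnn k))/=] := c0.
rewrite sub0r normrN => /(le_trans (ler_norm _)) hk.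
have {}diff s := le_trans (diff k s) hk.
have chk : crosscorr (h_ k) g (s_ n) @[n --> \oo] --> crosscorr (h_ k) g tau.
  have [mh _] := sh k; have [b hkb] := hb k.
  under eq_cvg do rewrite crosscorrE//; rewrite crosscorrE//.
  apply: (@Rintegral_dominated_cvg _ _ _ mu
    (fun n x => h_ k (x + s_ n) * g x) (fun x => h_ k (x + tau) * g x)
    (fun x => b * `|g x|)).
  - by move=> n; have [] := sqint_mul_integrable (sqint_shift (s_ n) (sh k)) sg
      => /measurable_int/measurable_EFinP.
  - by apply: measurable_funM => //; have [] := sqint_shift tau (sh k).
  - move=> x; apply: cvgM; last exact: cvg_cst.
    apply: (@cvg_comp _ _ _ (fun n => x + s_ n) (h_ k)); last exact: ch.
    by apply: cvgD => //; exact: cvg_cst.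
  - exact: (integrableZl measurableT b (integrable_norm ig)).
  - by move=> n x; rewrite normrM ler_wpM2r.
near=> n.
have h1 : `|crosscorr (h_ k) g tau - crosscorr (h_ k) g (s_ n)| <= e / 3.
  by near: n; move/cvgrPdist_le : chk; apply.
have := diff tau; have := diff (s_ n); move: h1.
rewrite !ler_norml => /andP[? ?] /andP[? ?] /andP[? ?].
by apply/andP; split; lra.
Unshelve. all: by end_near. Qed.

(** Substitute x = s + y and integrate over y first. Thus a double integral
    against a function of x - y depends on f and g through their
    cross-correlation only: with a cosine for h this expresses the
    cross-spectrum, and with an autocovariance the covariance of two
    coefficients. *)
Lemma Rintegral_conv_crosscorr h f g :
  measurable_fun setT h -> sqint mu f -> sqint mu g ->
  (mu \x mu)%E.-integrable setT
    (EFin \o (fun z : measurableTypeR R * measurableTypeR R =>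
      h (z.1 - z.2) * (f z.1 * g z.2))) ->
  mu.-integrable setT (EFin \o (fun s => h s * crosscorr f g s)) /\
  \int[(mu \x mu)%E]_z (h (z.1 - z.2) * (f z.1 * g z.2)) =
  \int[mu]_s (h s * crosscorr f g s).
Proof.
move=> mh sf sg iK; have [mf f2] := sf; have [mg g2] := sg.
have [iK1 eK1] := Rintegral21 iK; rewrite -eK1 {eK1}.
have mK' : measurable_fun setT
    (fun z : measurableTypeR R * measurableTypeR R =>
      h z.1 * (f (z.1 + z.2) * g z.2)).
  apply: measurable_funM; first exact: measurableT_comp.
  apply: measurable_funM; last exact: measurableT_comp.
  by apply: (measurableT_comp mf); exact: measurable_funD.
have mK := measurable_int _ iK.
have iK' : (mu \x mu)%E.-integrable setT
    (EFin \o (fun z : measurableTypeR R * measurableTypeR R =>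
      h z.1 * (f (z.1 + z.2) * g z.2))).
  apply/integrable21ltyP; first exact/measurable_EFinP.
  have := (integrable21ltyP _ _ mK).1 iK; apply: le_lt_trans.
  rewrite le_eqVlt; apply/orP; left; apply/eqP; apply: eq_integral => y _.
  rewrite -[RHS](@integral_isometry R 1 y) ?normr1//; last first.
    apply: measurableT_comp => //.
    by apply: (measurableT_comp mK); exact: measurable_fun_pair.
  by apply: eq_integral => x _ /=; rewrite mul1r addrK.
have [_ eK'21] := Rintegral21 iK'; have [iK'1 eK'12] := Rintegral12 iK'.
have inner s : \int[mu]_y (h s * (f (s + y) * g y)) = h s * crosscorr f g s.
  have isg := sqint_mul_integrable (sqint_shift s sf) sg.
  rewrite RintegralZl//; last first.
    by apply: eq_integrable isg => // x _ /=; rewrite addrC.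
  by rewrite crosscorrE//; congr (_ * _); apply: eq_Rintegral => x _; rewrite addrC.
split; first by apply: eq_integrable iK'1 => // s _ /=; rewrite inner.
transitivity (\int[mu]_y (\int[mu]_s (h s * (f (s + y) * g y)))).
  apply: eq_Rintegral => y _ /=.
  rewrite -(@Rintegral_shift R y (fun x => h (x - y) * (f x * g y))).
    by apply: eq_Rintegral => x _; rewrite addrK.
  apply: measurable_funM; last exact: measurable_funM.
  by apply: (measurableT_comp mh); exact: measurable_funB.
rewrite [LHS]eK'21 -[LHS]eK'12; apply: eq_Rintegral => s _ /=.
exact: inner.
Qed.

End crosscorr_theory.


(** * The Poisson kernel *)

Lemma norm_cos_le1 {R : realType} (x : R) : `|cos x| <= 1.
Proof. by rewrite ler_norml cos_geN1 cos_le1. Qed.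

Lemma norm_sin_le1 {R : realType} (x : R) : `|sin x| <= 1.
Proof. by rewrite ler_norml sin_geN1 sin_le1. Qed.

Section poisson.
Context {R : realType}.
Notation mu := (@lebesgue_measure R).
Implicit Types (f F : R -> R) (e z w u : R).

(** Only the derivative on the right half-line matters, so that an even
    function such as the exponential of [- `|x|] needs no smoothness at 0. *)
Lemma even_integral_primitive f F (l : R) : (forall x, 0 <= f x) ->
  continuous f -> (forall x, f (- x) = f x) ->
  (forall x : R, 0 < x -> is_derive x 1 F (f x)) -> {for 0, continuous F} ->
  F x @[x --> +oo] --> l ->
  mu.-integrable setT (EFin \o f) /\ \int[mu]_x f x = 2 * (l - F 0).
Proof.
move=> f0 cf fe dF cF Fl.
have I : (\int[mu]_x (f x)%:E = (2 * (l - F 0))%:E)%E.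
  rewrite ge0_symfun_integralT//; last by move=> x /=; rewrite fe.
  have -> : [set x : R | 0 <= x] = `[0, +oo[%classic.
    by apply/seteqP; split => x/=; rewrite in_itv/= andbT.
  rewrite (@ge0_continuous_FTC2y _ f F 0 l)//.
  - exact: continuous_subspaceT.
  - by move=> x x0; have [] := dF x x0.
  - exact: cvg_at_right_filter.
  - move=> x; rewrite in_itv/= andbT => x0; rewrite derive1E.
    by have [_ ->] := dF x x0.
split; last by rewrite /Rintegral I.
apply/integrableP; split.
  by apply/measurable_EFinP; exact: continuous_measurable_fun.
rewrite (_ : (fun x => `|(EFin \o f) x|)%E = (fun x => (f x)%:E)); last first.
  by apply/funext => x /=; rewrite ger0_norm.
by rewrite [ltLHS]I ltry.
Qed.

Definition cauchy_density u : R := 2 / (1 + u ^+ 2).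

Lemma cauchy_density_ge0 u : 0 <= cauchy_density u.
Proof. by rewrite divr_ge0// addr_ge0// sqr_ge0. Qed.

Lemma continuous_cauchy_density : continuous cauchy_density.
Proof.
move=> x; apply: cvgM; first exact: cvg_cst.
apply: cvgV; first by rewrite gt_eqF// ltr_pwDl// sqr_ge0.
apply: cvgD; first exact: cvg_cst.
exact: exprn_continuous.
Qed.

Lemma integral_cauchy_density : mu.-integrable setT (EFin \o cauchy_density) /\
  \int[mu]_u cauchy_density u = 2 * pi.
Proof.
have [] := @even_integral_primitive cauchy_density (fun x => 2 * atan x)
  (2 * (pi / 2)).
- exact: cauchy_density_ge0.
- exact: continuous_cauchy_density.
- by move=> x; rewrite /cauchy_density sqrrN.
- by apply: cvgM; [exact: cvg_cst|exact: continuous_atan].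
- by apply: cvgM; [exact: cvg_cst|exact: cvgy_atan].
by move=> ? ->; split => //; rewrite atan0 mulr0 subr0 [2 * (pi / 2)]mulrC divfK.
Qed.

Let continuous_expabs e : continuous (fun w => expR (- (e * `|w|)) : R).
Proof.
move=> w; apply: (@cvg_comp _ _ _ (fun w => - (e * `|w|)) expR); last first.
  exact: continuous_expR.
by apply: cvgN; apply: cvgM; [exact: cvg_cst|exact: norm_continuous].
Qed.

Let continuous_cosM z : continuous (fun w => cos (z * w) : R).
Proof.
move=> w; apply: (@cvg_comp _ _ _ (fun w => z * w) cos); last first.
  exact: continuous_cos.
by apply: cvgM; [exact: cvg_cst|exact: cvg_id].
Qed.

(** Adding 1 to the cosine makes the integrand nonnegative, so that the integral
    over the half-line is given by the variation of a primitive. *)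
Let expabs_cos1 e z : 0 < e ->
  mu.-integrable setT
    (EFin \o (fun w => expR (- (e * `|w|)) * (1 + cos (z * w)))) /\
  \int[mu]_w (expR (- (e * `|w|)) * (1 + cos (z * w))) =
  2 * (e / (e ^+ 2 + z ^+ 2) + e^-1).
Proof.
move=> e0.
have ez0 : 0 < e ^+ 2 + z ^+ 2.
  by rewrite ltr_pwDl ?sqr_ge0// exprn_gt0.
(* F is the primitive, for w > 0, that vanishes at infinity. *)
pose D := e ^+ 2 + z ^+ 2.
pose A w : R := z / D * sin (z * w) + - (e / D) * cos (z * w) + - e^-1.
pose F w : R := expR (- e * w) * A w.
have dscale c w : is_derive w 1 (fun w => c * w) c.
  exact: (is_derive_eq (is_deriveZ c (is_derive_id w (1 : R))) (mulr1 c)).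
have dF w : is_derive w 1 F (expR (- (e * w)) * (1 + cos (z * w))).
  have d1 : is_derive w 1 (fun w => expR (- e * w)) (expR (- e * w) * - e).
    exact: (is_derive1_comp (is_derive_expR _) (dscale (- e) w)).
  have d2 : is_derive w 1 (fun w => sin (z * w)) (cos (z * w) * z).
    exact: (is_derive1_comp (is_derive_sin _) (dscale z w)).
  have d3 : is_derive w 1 (fun w => cos (z * w)) (- sin (z * w) * z).
    exact: (is_derive1_comp (is_derive_cos _) (dscale z w)).
  have dA := is_deriveD (is_deriveD (is_deriveZ (z / D) d2)
    (is_deriveZ (- (e / D)) d3)) (is_derive_cst (- e^-1) w (1 : R)).
  apply: (is_derive_eq (is_deriveM d1 dA)).
  rewrite /GRing.scale/= -[(_ + _ + cst _) w]/(A w) /A /D mulNr.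
  by field; rewrite !gt_eqF.
have [] := @even_integral_primitive
  (fun w => expR (- (e * `|w|)) * (1 + cos (z * w))) F 0.
- move=> x; apply: mulr_ge0; first exact: expR_ge0.
  by have := cos_geN1 (z * x); lra.
- move=> x; apply: cvgM; first exact: continuous_expabs.
  by apply: cvgD; [exact: cvg_cst|exact: continuous_cosM].
- by move=> x; rewrite normrN mulrN cosN.
- by move=> x x0; have := dF x; rewrite (gtr0_norm x0).
- by apply/differentiable_continuous/derivable1_diffP; have [] := dF 0.
- pose K := `|z / D| + `|e / D| + `|e^-1|.
  have AK w : `|A w| <= K.
    rewrite /A /K (le_trans (ler_normD _ _))// normrN lerD2r.
    rewrite (le_trans (ler_normD _ _))// (normrM (z / D)) (normrM (- _)) normrN.
    by rewrite lerD// ler_piMr// ?norm_sin_le1 ?norm_cos_le1.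
  have cE : K * expR (- e * w) @[w --> +oo] --> (K * 0 : R).
    apply: cvgM; first exact: cvg_cst.
    under eq_cvg do rewrite mulNr.
    apply: (@cvg_comp _ _ _ (fun w => e * w) (fun w => expR (- w))).
      exact: gt0_cvgMry.
    exact: cvgr_expR.
  rewrite mulr0 in cE; apply/norm_cvg0P.
  apply: (squeeze_cvgr _ (cvg_cst 0) cE); apply: nearW => w.
  rewrite normr_ge0/= /F normrM (ger0_norm (expR_ge0 _)) mulrC.
  by rewrite ler_wpM2r ?expR_ge0.
move=> ? ->; split => //.
rewrite /F /A /D !mulr0 expR0 sin0 cos0; field.
by rewrite !gt_eqF.
Qed.

Lemma integrable_expabs e : 0 < e ->
  mu.-integrable setT (EFin \o (fun w => expR (- (e * `|w|)))).
Proof.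
move=> e0; have [i0 _] := expabs_cos1 0 e0.
have := integrableZl measurableT (2^-1) i0.
apply: eq_integrable => // w _ /=.
by rewrite mul0r cos0; congr EFin; field.
Qed.

Lemma integral_expabs_cos e z : 0 < e ->
  mu.-integrable setT (EFin \o (fun w => expR (- (e * `|w|)) * cos (z * w))) /\
  \int[mu]_w (expR (- (e * `|w|)) * cos (z * w)) = 2 * e / (e ^+ 2 + z ^+ 2).
Proof.
move=> e0; have iE := integrable_expabs e0.
have [_ I0] := expabs_cos1 0 e0; have [iz Iz] := expabs_cos1 z e0.
have ic : mu.-integrable setT
    (EFin \o (fun w => expR (- (e * `|w|)) * cos (z * w))).
  have := integrableB measurableT iz iE; apply: eq_integrable => // w _ /=.
  by congr EFin; ring.
have IE : \int[mu]_w expR (- (e * `|w|)) = 2 * e^-1.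
  have : 2 * \int[mu]_w expR (- (e * `|w|)) = 2 * (e / (e ^+ 2 + 0 ^+ 2) + e^-1).
    rewrite -I0 -(RintegralZl 2 measurableT iE).
    by apply: eq_Rintegral => w _; rewrite mul0r cos0; ring.
  by move=> /(mulfI _)-> //; field; rewrite gt_eqF.
split => //; apply: (@addrI _ (\int[mu]_w expR (- (e * `|w|)))).
rewrite -(RintegralD measurableT iE ic).
under eq_Rintegral do rewrite -[X in X + _]mulr1 -mulrDr.
rewrite Iz IE; field.
by rewrite !gt_eqF//= ltr_pwDl ?sqr_ge0// exprn_gt0.
Qed.

End poisson.


(** * Parseval's identity for integrable functions *)

Section smoothed_parseval.
Context {R : realType}.
Notation mu := (@lebesgue_measure R).
Implicit Types (f g : R -> R) (e s tau w u : R).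

Definition cosT f w : R := \int[mu]_t (f t * cos (w * t)).
Definition sinT f w : R := \int[mu]_t (f t * sin (w * t)).

(** The real part of [(a + i b) * conj (c + i d) * exp (i w tau)]. *)
Definition rotated_cross (a b c d : R) w tau : R :=
  cos (w * tau) * (a * c + b * d) - sin (w * tau) * (b * c - a * d).

(** The transform of f being [cosT f - i sinT f]. *)
Definition cross_spectrum f g tau w : R :=
  rotated_cross (cosT f w) (- sinT f w) (cosT g w) (- sinT g w) w tau.

Lemma integrable_Mcos f w : mu.-integrable setT (EFin \o f) ->
  mu.-integrable setT (EFin \o (fun t => f t * cos (w * t))).
Proof.
move=> fi; apply: (le_integrable measurableT _ _ fi).
  apply/measurable_EFinP/measurable_funM.
    by have /measurable_EFinP := measurable_int _ fi.
  apply: continuous_measurable_fun => x.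
  apply: (@cvg_comp _ _ _ (fun t => w * t) cos); last exact: continuous_cos.
  exact: mulrl_continuous.
by move=> x _; rewrite /= lee_fin normrM ler_piMr// norm_cos_le1.
Qed.

Lemma integrable_Msin f w : mu.-integrable setT (EFin \o f) ->
  mu.-integrable setT (EFin \o (fun t => f t * sin (w * t))).
Proof.
move=> fi; apply: (le_integrable measurableT _ _ fi).
  apply/measurable_EFinP/measurable_funM.
    by have /measurable_EFinP := measurable_int _ fi.
  apply: continuous_measurable_fun => x.
  apply: (@cvg_comp _ _ _ (fun t => w * t) sin); last exact: continuous_sin.
  exact: mulrl_continuous.
by move=> x _; rewrite /= lee_fin normrM ler_piMr// norm_sin_le1.
Qed.

(** The addition formulas for [cos ((tau - (x - y)) * w)]. *)
Lemma cross_spectrumE f g tau w :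
  mu.-integrable setT (EFin \o f) -> mu.-integrable setT (EFin \o g) ->
  cross_spectrum f g tau w =
  \int[(mu \x mu)%E]_z (f z.1 * g z.2 * cos ((tau - (z.1 - z.2)) * w)).
Proof.
move=> fi gi.
have ifc := integrable_Mcos w fi; have ifs := integrable_Msin w fi.
have igc := integrable_Mcos w gi; have igs := integrable_Msin w gi.
pose c := cos (w * tau); pose s := sin (w * tau).
have icc := integrableZl measurableT c (integrable_prodM ifc igc).
have iss := integrableZl measurableT c (integrable_prodM ifs igs).
have isc := integrableZl measurableT s (integrable_prodM ifs igc).
have ics := integrableZl measurableT (- s) (integrable_prodM ifc igs).
have i1 := integrableD measurableT icc iss.
have i2 := integrableD measurableT i1 isc.
rewrite /cross_spectrum /rotated_cross -/c -/s.
transitivity (c * (cosT f w * cosT g w) + c * (sinT f w * sinT g w)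
  + s * (sinT f w * cosT g w) + (- s) * (cosT f w * sinT g w)); first by ring.
rewrite -(Rintegral_prodM ifc igc) -(Rintegral_prodM ifs igs).
rewrite -(Rintegral_prodM ifs igc) -(Rintegral_prodM ifc igs).
rewrite -(RintegralZl c measurableT (integrable_prodM ifc igc)).
rewrite -(RintegralZl c measurableT (integrable_prodM ifs igs)).
rewrite -(RintegralZl s measurableT (integrable_prodM ifs igc)).
rewrite -(RintegralZl (- s) measurableT (integrable_prodM ifc igs)).
rewrite -(RintegralD measurableT icc iss) -(RintegralD measurableT i1 isc).
rewrite -(RintegralD measurableT i2 ics).
apply: eq_Rintegral => -[x y] _ /=.
have -> : (tau - (x - y)) * w = w * tau - (w * x - w * y) by ring.
by rewrite cosB [cos (w * x - _)]cosB [sin (w * x - _)]sinB -/c -/s; ring.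
Qed.

Let measurable_cos_shift tau w :
  measurable_fun setT (fun s => cos ((tau - s) * w) : R).
Proof.
apply: continuous_measurable_fun => s.
apply: (@cvg_comp _ _ _ (fun s => (tau - s) * w) cos); last exact: continuous_cos.
apply: cvgM; last exact: cvg_cst.
by apply: cvgB; [exact: cvg_cst|exact: cvg_id].
Qed.

(** The cross-spectrum is the real part of [exp (i w tau)] times the Fourier
    transform of the cross-correlation: this is [Rintegral_conv_crosscorr] for a
    cosine, and for the constant 1 (integrability). *)
Lemma cross_spectrum_crosscorr f g tau w : sqint mu f -> sqint mu g ->
  mu.-integrable setT (EFin \o f) -> mu.-integrable setT (EFin \o g) ->
  mu.-integrable setT (EFin \o crosscorr f g) /\
  cross_spectrum f g tau w =
  \int[mu]_s (cos ((tau - s) * w) * crosscorr f g s).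
Proof.
move=> sf sg fi gi; have ifg := integrable_prodM fi gi.
have mfg := measurable_int _ ifg.
split.
  have [] := @Rintegral_conv_crosscorr R (fun=> 1) f g _ sf sg.
  - exact: measurable_cst.
  - by apply: eq_integrable ifg => // z _ /=; rewrite mul1r.
  - by move=> + _; apply: eq_integrable => // s _ /=; rewrite mul1r.
have [] := @Rintegral_conv_crosscorr R (fun s => cos ((tau - s) * w)) f g
  _ sf sg.
- exact: measurable_cos_shift.
- apply: (le_integrable measurableT _ _ ifg).
    apply/measurable_EFinP/measurable_funM; last exact/measurable_EFinP.
    apply: (measurableT_comp (measurable_cos_shift tau w)).
    exact: measurable_funB.
  by move=> z _; rewrite /= lee_fin normrM ler_piMl// norm_cos_le1.
move=> _ <-; rewrite cross_spectrumE//.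
by apply: eq_Rintegral => z _; rewrite mulrC.
Qed.

Definition poisson e z : R := 2 * e / (e ^+ 2 + z ^+ 2).

(** Integrating the previous formula against [expR (- (e * `|w|))] first in w
    brings out the Poisson kernel. *)
Lemma smoothed_cross_spectrum f g e tau : 0 < e -> sqint mu f -> sqint mu g ->
  mu.-integrable setT (EFin \o f) -> mu.-integrable setT (EFin \o g) ->
  [/\ mu.-integrable setT
        (EFin \o (fun w => expR (- (e * `|w|)) * cross_spectrum f g tau w)),
      mu.-integrable setT
        (EFin \o (fun s => poisson e (tau - s) * crosscorr f g s)) &
      \int[mu]_w (expR (- (e * `|w|)) * cross_spectrum f g tau w) =
      \int[mu]_s (poisson e (tau - s) * crosscorr f g s)].
Proof.
move=> e0 sf sg fi gi.
have iE := @integrable_expabs R e e0.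
have [ic _] := cross_spectrum_crosscorr 0 0 sf sg fi gi.
have iEc := integrable_prodM iE ic.
have iP : (mu \x mu)%E.-integrable setT
    (EFin \o (fun z : measurableTypeR R * measurableTypeR R =>
      expR (- (e * `|z.1|)) *
      (cos ((tau - z.2) * z.1) * crosscorr f g z.2))).
  apply: (le_integrable measurableT _ _ iEc).
    have mEc := measurable_int _ iEc.
    apply/measurable_EFinP.
    rewrite (_ : (fun z => _) = (fun z : measurableTypeR R * measurableTypeR R =>
      expR (- (e * `|z.1|)) * crosscorr f g z.2 * cos ((tau - z.2) * z.1))).
      apply: measurable_funM; first exact/measurable_EFinP.
      apply: measurableT_comp.
        by apply: continuous_measurable_fun; exact: continuous_cos.
      by apply: measurable_funM => //; exact: measurable_funB.
    by apply/funext => z; ring.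
  move=> z _; rewrite /= lee_fin !normrM ler_wpM2l// ler_piMl//.
  exact: norm_cos_le1.
have [i1 e1] := Rintegral12 iP; have [i2 e2] := Rintegral21 iP.
have inner1 w : \int[mu]_s (expR (- (e * `|w|)) *
    (cos ((tau - s) * w) * crosscorr f g s)) =
    expR (- (e * `|w|)) * cross_spectrum f g tau w.
  rewrite (cross_spectrum_crosscorr tau w sf sg fi gi).2 RintegralZl//.
  apply: (le_integrable measurableT _ _ ic).
    apply/measurable_EFinP/measurable_funM; first exact: measurable_cos_shift.
    by apply/measurable_EFinP; exact: measurable_int ic.
  by move=> s _; rewrite /= lee_fin normrM ler_piMl// norm_cos_le1.
have inner2 s : \int[mu]_w (expR (- (e * `|w|)) *
    (cos ((tau - s) * w) * crosscorr f g s)) =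
    poisson e (tau - s) * crosscorr f g s.
  have [ie Ie] := integral_expabs_cos (tau - s) e0.
  rewrite /poisson -Ie -RintegralZr//.
  by apply: eq_Rintegral => w _; ring.
split.
- by apply: eq_integrable i1 => // w _ /=; rewrite inner1.
- by apply: eq_integrable i2 => // s _ /=; rewrite inner2.
under eq_Rintegral do rewrite -inner1.
rewrite [LHS]e1 -[LHS]e2; apply: eq_Rintegral => s _ /=.
exact: inner2.
Qed.

(** The Poisson kernel of parameter e is the dilation by e of
    [cauchy_density], of mass 2 pi; as e tends to 0 it concentrates at 0. *)
Lemma poisson_approx_identity f g tau : sqint mu f -> sqint mu g ->
  mu.-integrable setT (EFin \o f) -> mu.-integrable setT (EFin \o g) ->
  \int[mu]_w (expR (- (n.+1%:R^-1 * `|w|)) * cross_spectrum f g tau w)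
    @[n --> \oo] --> 2 * pi * crosscorr f g tau.
Proof.
move=> sf sg fi gi.
have [icd Icd] := @integral_cauchy_density R.
pose e (n : nat) : R := n.+1%:R^-1.
have e0 n : 0 < e n by rewrite invr_gt0.
have scale n u : e n * (poisson (e n) (tau - (e n * u + tau)) *
    crosscorr f g (e n * u + tau)) =
    cauchy_density u * crosscorr f g (e n * u + tau).
  rewrite mulrA; congr (_ * _); rewrite /poisson /cauchy_density.
  have -> : tau - (e n * u + tau) = - (e n * u) by ring.
  have u0 : 1 + u ^+ 2 != 0 by rewrite gt_eqF// ltr_pwDl// sqr_ge0.
  have en0 : e n != 0 by rewrite gt_eqF.
  have -> : e n ^+ 2 + (- (e n * u)) ^+ 2 = e n ^+ 2 * (1 + u ^+ 2) by ring.
  by field; rewrite u0 en0.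
have key n : mu.-integrable setT
     (EFin \o (fun u => cauchy_density u * crosscorr f g (e n * u + tau))) /\
   \int[mu]_w (expR (- (e n * `|w|)) * cross_spectrum f g tau w) =
   \int[mu]_u (cauchy_density u * crosscorr f g (e n * u + tau)).
  have [_ ip ->] := smoothed_cross_spectrum tau (e0 n) sf sg fi gi.
  have en0 : e n != 0 by rewrite gt_eqF.
  have ia := integrableZl measurableT (e n) (integrable_affine tau en0 ip).
  split; first by apply: eq_integrable ia => // u _; congr EFin; exact: scale.
  under [RHS]eq_Rintegral do rewrite -scale.
  rewrite RintegralZl//; last exact: (integrable_affine tau en0 ip).
  rewrite (Rintegral_affine tau en0 ip) gtr0_norm// mulrA divff// mul1r.
  by [].
under eq_cvg do rewrite (key _).2.
rewrite -Icd -RintegralZr//.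
pose K := Num.sqrt (\int[mu]_x (f x ^+ 2)) * Num.sqrt (\int[mu]_x (g x ^+ 2)).
apply: (@Rintegral_dominated_cvg _ _ _ mu
  (fun n u => cauchy_density u * crosscorr f g (e n * u + tau))
  (fun u => cauchy_density u * crosscorr f g tau)
  (fun u => K * cauchy_density u)).
- by move=> n; have [/(measurable_int _)/measurable_EFinP] := key n.
- apply: measurable_funM => //.
  by apply: continuous_measurable_fun; exact: continuous_cauchy_density.
- move=> u; apply: cvgM; first exact: cvg_cst.
  apply: crosscorr_cvg => //.
  rewrite -[X in _ --> X]add0r -(mul0r u).
  apply: cvgD; last exact: cvg_cst.
  apply: cvgM; last exact: cvg_cst.
  exact: cvg_harmonic.
- exact: (integrableZl measurableT K icd).
- move=> n u; rewrite normrM (ger0_norm (cauchy_density_ge0 u)) [K * _]mulrC.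
  by rewrite ler_wpM2l ?cauchy_density_ge0// norm_crosscorr_le.
Qed.

End smoothed_parseval.


(** Monotone convergence, where it is the finiteness of the limit of the
    integrals that gives the integrability of the limit. *)
Lemma integrable_nondecreasing_limit {R : realType} {d : measure_display}
    {T : measurableType d} (mu : {measure set T -> \bar R})
    (q_ : nat -> T -> R) (q : T -> R) (L : R) :
  (forall n, mu.-integrable setT (EFin \o q_ n)) -> (forall n x, 0 <= q_ n x) ->
  (forall x, {homo q_ ^~ x : m n / (m <= n)%N >-> m <= n}) ->
  measurable_fun setT q -> (forall x, q_ n x @[n --> \oo] --> q x) ->
  \int[mu]_x q_ n x @[n --> \oo] --> L -> mu.-integrable setT (EFin \o q).
Proof.
move=> iq q0 ndq mq cq cL.
have qge0 x : 0 <= q x.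
  rewrite -(cvg_lim _ (cq x))//; apply: limr_ge; first exact: cvgP (cq x).
  by apply: nearW => n.
have cI := @cvg_monotone_convergence _ T R mu setT measurableT
  (fun n x => (q_ n x)%:E) (fun n => measurable_int _ (iq n))
  (fun n x _ => q0 n x) (fun x _ m n mn => ndq x m n mn).
have limE x : limn (fun n => (q_ n x)%:E) = (q x)%:E.
  by apply/cvg_lim => //; apply: cvg_EFin; [exact: nearW|exact: cq].
have cL' : (\int[mu]_x (q_ n x)%:E)%E @[n --> \oo] --> L%:E.
  rewrite (_ : (fun n => _) = (fun n => (\int[mu]_x q_ n x)%:E)).
    by apply: cvg_EFin; [exact: nearW|exact: cL].
  by apply/funext => n; rewrite /Rintegral fineK//; exact: integrable_fin_num (iq n).
apply/integrableP; split; first exact/measurable_EFinP.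
rewrite (_ : (\int[mu]_x _)%E = L%:E) ?ltry//.
have := cvg_unique _ cI cL'; move=> <- //.
apply: eq_integral => x _ /=; rewrite limE ger0_norm//.
Qed.

Section parseval_L1.
Context {R : realType}.
Notation mu := (@lebesgue_measure R).
Implicit Types (f g : R -> R) (tau w : R).

Let measurable_fourier (k : R -> R) f : continuous k ->
  mu.-integrable setT (EFin \o f) ->
  measurable_fun setT (fun w => \int[mu]_t (f t * k (w * t))).
Proof.
move=> ck /(measurable_int _)/measurable_EFinP mf.
apply: (@measurable_Rintegral R _ _ _ _ mu
  (fun z : measurableTypeR R * measurableTypeR R => f z.2 * k (z.1 * z.2))).
apply: measurable_funM; first exact: measurableT_comp.
apply: measurableT_comp; last exact: measurable_funM.
exact: continuous_measurable_fun.
Qed.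

Let cvg_damping w : expR (- (n.+1%:R^-1 * `|w|)) @[n --> \oo] --> (1 : R).
Proof.
have c0 : - (n.+1%:R^-1 * `|w|) @[n --> \oo] --> (0 : R).
  rewrite -oppr0 -(mul0r `|w|); apply: cvgN; apply: cvgM; last exact: cvg_cst.
  exact: cvg_harmonic.
by have := cvg_comp _ _ c0 (@continuous_expR R 0); rewrite expR0.
Qed.

Let measurable_cosT f : mu.-integrable setT (EFin \o f) ->
  measurable_fun setT (cosT f).
Proof.
by apply: measurable_fourier; exact: continuous_cos.
Qed.

Let measurable_sinT f : mu.-integrable setT (EFin \o f) ->
  measurable_fun setT (sinT f).
Proof.
by apply: measurable_fourier; exact: continuous_sin.
Qed.

(** The damped integrals of the energy spectrum increase, and they converge by
    [poisson_approx_identity] with f = g and tau = 0. *)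
Lemma sqint_cosT_sinT f : sqint mu f -> mu.-integrable setT (EFin \o f) ->
  sqint mu (cosT f) /\ sqint mu (sinT f).
Proof.
move=> sf fi.
have mc := measurable_cosT fi; have ms := measurable_sinT fi.
pose q w := cosT f w ^+ 2 + sinT f w ^+ 2.
have q0 w : 0 <= q w by rewrite addr_ge0 ?sqr_ge0.
have qE w : cross_spectrum f f 0 w = q w.
  by rewrite /cross_spectrum /rotated_cross mulr0 cos0 sin0 /q; ring.
have mq : measurable_fun setT q.
  by apply: measurable_funD; exact: measurable_funX.
have iq : mu.-integrable setT (EFin \o q).
  have cL := poisson_approx_identity (tau := 0) sf sf fi fi.
  apply: (@integrable_nondecreasing_limit _ _ _ mu
    (fun n w => expR (- (n.+1%:R^-1 * `|w|)) * cross_spectrum f f 0 w) q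
    (2 * pi * crosscorr f f 0)) => //.
  - move=> n; have n0 : 0 < n.+1%:R^-1 :> R by rewrite invr_gt0.
    by have [] := smoothed_cross_spectrum 0 n0 sf sf fi fi.
  - by move=> n w; rewrite qE mulr_ge0// expR_ge0.
  - move=> w m n mn; rewrite qE ler_wpM2r// ler_expR lerN2 ler_wpM2r//.
    by rewrite lef_pV2 ?posrE// ler_nat.
  - move=> w; rewrite qE -[X in _ --> X]mul1r.
    by apply: cvgM; [exact: cvg_damping|exact: cvg_cst].
split; split => //; apply: (le_integrable measurableT _ _ iq).
- exact/measurable_EFinP/measurable_funX.
- move=> w _; rewrite /= lee_fin !ger0_norm ?sqr_ge0//.
  by rewrite lerDl sqr_ge0.
- exact/measurable_EFinP/measurable_funX.
- move=> w _; rewrite /= lee_fin !ger0_norm ?sqr_ge0//.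
  by rewrite lerDr sqr_ge0.
Qed.

Lemma measurable_cosMr tau : measurable_fun setT (fun w => cos (w * tau) : R).
Proof.
apply: continuous_measurable_fun => x.
apply: (@cvg_comp _ _ _ (fun w => w * tau) cos); last exact: continuous_cos.
exact: mulrr_continuous.
Qed.

Lemma measurable_sinMr tau : measurable_fun setT (fun w => sin (w * tau) : R).
Proof.
apply: continuous_measurable_fun => x.
apply: (@cvg_comp _ _ _ (fun w => w * tau) sin); last exact: continuous_sin.
exact: mulrr_continuous.
Qed.

Lemma Rintegral_rotated_cross (a b c d : R -> R) tau :
  sqint mu a -> sqint mu b -> sqint mu c -> sqint mu d ->
  mu.-integrable setT
    (EFin \o (fun w => rotated_cross (a w) (b w) (c w) (d w) w tau)) /\
  \int[mu]_w rotated_cross (a w) (b w) (c w) (d w) w tau =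
  \int[mu]_w (cos (w * tau) * (a w * c w)) +
  \int[mu]_w (cos (w * tau) * (b w * d w)) -
  \int[mu]_w (sin (w * tau) * (b w * c w)) +
  \int[mu]_w (sin (w * tau) * (a w * d w)).
Proof.
move=> sa sb sc sd.
have boundM (k u v : R -> R) : measurable_fun setT k ->
    (forall x, `|k x| <= 1) -> sqint mu u -> sqint mu v ->
    mu.-integrable setT (EFin \o (fun w => k w * (u w * v w))).
  move=> mk k1 su sv; have iuv := sqint_mul_integrable su sv.
  apply: (le_integrable measurableT _ _ iuv).
    apply/measurable_EFinP/measurable_funM => //.
    by apply/measurable_EFinP; exact: measurable_int iuv.
  by move=> x _; rewrite /= lee_fin normrM ler_piMl.
have i1 := boundM _ _ _ (measurable_cosMr tau) (fun x => norm_cos_le1 _) sa sc.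
have i2 := boundM _ _ _ (measurable_cosMr tau) (fun x => norm_cos_le1 _) sb sd.
have i3 := boundM _ _ _ (measurable_sinMr tau) (fun x => norm_sin_le1 _) sb sc.
have i4 := boundM _ _ _ (measurable_sinMr tau) (fun x => norm_sin_le1 _) sa sd.
have i12 := integrableD measurableT i1 i2.
have i123 := integrableB measurableT i12 i3.
have i1234 := integrableD measurableT i123 i4.
split.
  apply: eq_integrable i1234 => // w _ /=.
  by congr EFin; rewrite /rotated_cross; ring.
rewrite -(RintegralD measurableT i1 i2) -(RintegralB measurableT i12 i3).
rewrite -(RintegralD measurableT i123 i4).
by apply: eq_Rintegral => w _; rewrite /rotated_cross; ring.
Qed.

(** The cross-spectrum being integrable, the limit in
    [poisson_approx_identity] can be taken under the integral sign. *)
Lemma parseval_L1_L2 f g tau : sqint mu f -> sqint mu g ->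
  mu.-integrable setT (EFin \o f) -> mu.-integrable setT (EFin \o g) ->
  \int[mu]_w cross_spectrum f g tau w = 2 * pi * crosscorr f g tau.
Proof.
move=> sf sg fi gi.
have [scf ssf] := sqint_cosT_sinT sf fi; have [scg ssg] := sqint_cosT_sinT sg gi.
have neg h : sqint mu h -> sqint mu (fun x => - h x).
  by move=> /(sqintZ (-1)); under eq_fun do rewrite mulN1r.
have [iS _] := Rintegral_rotated_cross tau scf (neg _ ssf) scg (neg _ ssg).
have cL := poisson_approx_identity (tau := tau) sf sg fi gi.
apply: cvg_unique cL => //.
have iE (n : nat) : 0 < n.+1%:R^-1 :> R by rewrite invr_gt0.
apply: (@Rintegral_dominated_cvg _ _ _ mu
  (fun n w => expR (- (n.+1%:R^-1 * `|w|)) * cross_spectrum f g tau w)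
  (cross_spectrum f g tau) (fun w => `|cross_spectrum f g tau w|)).
- move=> n; have [/(measurable_int _)/measurable_EFinP] :=
    smoothed_cross_spectrum tau (iE n) sf sg fi gi.
  by [].
- by apply/measurable_EFinP; exact: measurable_int iS.
- move=> w; rewrite -[X in _ --> X]mul1r.
  by apply: cvgM; [exact: cvg_damping|exact: cvg_cst].
- exact: (integrable_norm iS).
- by move=> n w; rewrite normrM ler_piMl// ger0_norm ?expR_ge0.
Qed.

End parseval_L1.


(** * Parseval's identity for square-integrable functions *)

Section parseval_L2.
Context {R : realType}.
Notation mu := (@lebesgue_measure R).
Implicit Types (f g : R -> R) (F G : R -> R[i]) (tau w : R) (N : nat).

Lemma L2_sqint f : L2 f -> sqint mu f.
Proof.
move=> fL2; split; last exact: Lfun2_integrable_sqr.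
by have := sub_Lfun_mfun fL2; rewrite inE.
Qed.

Lemma sqint_cvg_mul_bounded (k : R -> R) (a_ b_ : nat -> R -> R) (a b : R -> R) :
  measurable_fun setT k -> (forall x, `|k x| <= 1) ->
  (forall n, sqint mu (a_ n)) -> (forall n, sqint mu (b_ n)) ->
  sqint mu a -> sqint mu b ->
  \int[mu]_x ((a_ n x - a x) ^+ 2) @[n --> \oo] --> 0 ->
  \int[mu]_x ((b_ n x - b x) ^+ 2) @[n --> \oo] --> 0 ->
  \int[mu]_x (k x * (a_ n x * b_ n x)) @[n --> \oo] -->
  \int[mu]_x (k x * (a x * b x)).
Proof.
move=> mk k1 sa_ sb_ sa sb ca cb.
have bounded h : sqint mu h -> sqint mu (fun x => k x * h x).
  move=> sh; have [mh _] := sh; apply: (le_sqint _ sh) => //.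
    exact: measurable_funM.
  by move=> x; rewrite normrM ler_piMl.
under eq_cvg do under eq_Rintegral do rewrite mulrA.
under eq_Rintegral do rewrite mulrA.
apply: (@sqint_cvg_mul R _ _ mu (fun n x => k x * a_ n x) b_
  (fun x => k x * a x) b) => //.
- by move=> n; exact: bounded.
- exact: bounded.
apply: (squeeze_cvgr _ (cvg_cst 0) ca); apply: nearW => n.
rewrite Rintegral_ge0 => [/=|x _]; last exact: sqr_ge0.
have [_ i1] := sqintB (sa_ n) sa.
have [_ i2] := sqintB (bounded _ (sa_ n)) (bounded _ sa).
apply: le_Rintegral => // x _; rewrite -mulrBr exprMn ler_piMl ?sqr_ge0//.
by rewrite -real_normK ?num_real// expr_le1.
Qed.

Definition trunc f N : R -> R := f \_ `[- N%:R, N%:R].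

Let trunc_le f N x : `|trunc f N x| <= `|f x|.
Proof. by rewrite /trunc patchE; case: ifP => // _; rewrite normr0. Qed.

Let sqint_trunc f N : sqint mu f -> sqint mu (trunc f N).
Proof.
move=> sf; apply: (le_sqint _ sf); last exact: trunc_le.
have [mf _] := sf.
apply/(measurable_restrictT f (measurable_itv _)); exact: measurable_funTS.
Qed.

Let integrable_trunc f N : sqint mu f ->
  mu.-integrable setT (EFin \o trunc f N).
Proof.
move=> sf.
have := sqint_mul_integrable sf (sqint_indic_itv (- N%:R) N%:R); apply: eq_integrable => // x _ /=.
by rewrite /trunc patchE indicE; case: ifP => _; rewrite ?mulr1 ?mulr0.
Qed.

Let cvg_trunc f : sqint mu f ->
  \int[mu]_x ((trunc f N x - f x) ^+ 2) @[N --> \oo] --> 0.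
Proof.
move=> sf; have [mf f2] := sf.
rewrite (_ : 0 = Rintegral mu setT (fun=> 0)); last first.
  by rewrite Rintegral_cst// mul0r.
apply: (@Rintegral_dominated_cvg _ _ _ mu (fun N x => (trunc f N x - f x) ^+ 2)
  (fun=> 0) (fun x => f x ^+ 2)) => //.
- by move=> N; apply: measurable_funX; have [] := sqintB (sqint_trunc N sf) sf.
- move=> x; apply: cvg_near_cst; near=> N.
  have Nx : `|x| <= N%:R by near: N; exact: nbhs_infty_ger.
  rewrite /trunc patchE mem_set/= ?subrr ?expr0n//.
  by rewrite in_itv/= -ler_norml.
- move=> N x; rewrite ger0_norm ?sqr_ge0//.
  rewrite /trunc patchE; case: ifP => _; first by rewrite subrr expr0n sqr_ge0.
  by rewrite sub0r sqrrN.
Unshelve. all: by end_near. Qed.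

Lemma Re_fourier_trunc f N w :
  complex.Re (fourier_trunc f N w) = cosT (trunc f N) w.
Proof.
rewrite /fourier_trunc /cintegral /cosT /= Rintegral_mkcond.
apply: eq_Rintegral => t _; rewrite /trunc !patchE.
by case: ifP => _; rewrite /= ?mul0r// subr0 cosN.
Qed.

Lemma Im_fourier_trunc f N w : sqint mu f ->
  complex.Im (fourier_trunc f N w) = - sinT (trunc f N) w.
Proof.
move=> sf; rewrite /fourier_trunc /cintegral /sinT /= Rintegral_mkcond.
rewrite -[RHS]mulN1r -RintegralZl//; last exact: integrable_Msin (integrable_trunc N sf).
apply: eq_Rintegral => t _; rewrite /trunc !patchE.
case: ifP => _ /=; last by rewrite mul0r mulr0.
by rewrite mul0r addr0 sinN; ring.
Qed.

(** The truncations of f have transforms [cosT - i sinT], which converge in L2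
    to F; in particular F is square-integrable. *)
Lemma is_fourier_cvg f F : L2 f -> is_fourier f F ->
  [/\ sqint mu (fun w => complex.Re (F w)), sqint mu (fun w => complex.Im (F w)),
    \int[mu]_w ((cosT (trunc f N) w - complex.Re (F w)) ^+ 2) @[N --> \oo] --> 0 &
    \int[mu]_w ((- sinT (trunc f N) w - complex.Im (F w)) ^+ 2)
      @[N --> \oo] --> 0].
Proof.
move=> /L2_sqint sf [mRe mIm cF].
pose a w := complex.Re (F w); pose b w := complex.Im (F w).
pose a_ N w := cosT (trunc f N) w; pose b_ N w := - sinT (trunc f N) w.
have sa_ N : sqint mu (a_ N).
  exact: (sqint_cosT_sinT (sqint_trunc N sf) (integrable_trunc N sf)).1.
have sb_ N : sqint mu (b_ N).
  have := (sqint_cosT_sinT (sqint_trunc N sf) (integrable_trunc N sf)).2.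
  by move=> /(sqintZ (-1)); under eq_fun do rewrite mulN1r.
pose q N w := (a_ N w - a w) ^+ 2 + (b_ N w - b w) ^+ 2.
have normcE N w : Normc.normc (F w - fourier_trunc f N w) ^+ 2 = q N w.
  have -> : F w - fourier_trunc f N w = ((a w - a_ N w) +i* (b w - b_ N w))%C.
    rewrite /a /b /a_ /b_ -Re_fourier_trunc -Im_fourier_trunc//.
    by case: (F w) => ? ?; case: (fourier_trunc f N w).
  rewrite /= sqr_sqrtr ?addr_ge0 ?sqr_ge0// /q.
  by rewrite -(sqrrN (a w - _)) -(sqrrN (b w - _)) !opprB.
have mq N : measurable_fun setT (q N).
  have [ma _] := sa_ N; have [mb _] := sb_ N.
  by apply: measurable_funD; apply: measurable_funX; exact: measurable_funB.
have q0 N w : 0 <= q N w by rewrite addr_ge0 ?sqr_ge0.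
have {cF} /fine_cvgP[finq cq] : (\int[mu]_w (q N w)%:E)%E @[N --> \oo] --> 0%E.
  move: cF; rewrite (_ : (fun N => _) = (fun N => \int[mu]_w (q N w)%:E)%E)//.
  by apply/funext => N; apply: eq_integral => w _; rewrite normcE.
have iq N : (\int[mu]_w (q N w)%:E)%E \is a fin_num ->
    mu.-integrable setT (EFin \o q N).
  move=> fin; apply/integrableP; split; first by apply/measurable_EFinP; exact: mq.
  rewrite (_ : (fun x => `|(EFin \o q N) x|)%E = (fun x => (q N x)%:E)).
    by rewrite ltey_eq fin.
  by apply/funext => w /=; rewrite ger0_norm.
have sD N : (\int[mu]_w (q N w)%:E)%E \is a fin_num ->
    sqint mu (fun w => a_ N w - a w) /\ sqint mu (fun w => b_ N w - b w).
  move=> /iq iqN; have [ma _] := sa_ N; have [mb _] := sb_ N.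
  split; (split; first exact: measurable_funB);
    apply: (le_integrable measurableT _ _ iqN);
    try (by apply/measurable_EFinP/measurable_funX/measurable_funB);
    by move=> w _; rewrite /= lee_fin !ger0_norm ?sqr_ge0// /q ?lerDl ?lerDr sqr_ge0.
have [N0 _ /(_ N0 (leqnn N0))/= /sD[sA sB]] := finq.
have sa : sqint mu a.
  by have := sqintB (sa_ N0) sA; under eq_fun do rewrite subKr.
have sb : sqint mu b.
  by have := sqintB (sb_ N0) sB; under eq_fun do rewrite subKr.
have iqT N : mu.-integrable setT (EFin \o q N).
  have [_ i1] := sqintB (sa_ N) sa; have [_ i2] := sqintB (sb_ N) sb.
  exact: (integrableD measurableT i1 i2).
split => //.
- apply: (squeeze_cvgr _ (cvg_cst 0) cq); apply: nearW => N.
  have [_ i1] := sqintB (sa_ N) sa.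
  rewrite Rintegral_ge0 => [/=|x _]; last exact: sqr_ge0.
  by apply: (le_Rintegral measurableT i1 (iqT N)) => w _; rewrite lerDl sqr_ge0.
- apply: (squeeze_cvgr _ (cvg_cst 0) cq); apply: nearW => N.
  have [_ i1] := sqintB (sb_ N) sb.
  rewrite Rintegral_ge0 => [/=|x _]; last exact: sqr_ge0.
  by apply: (le_Rintegral measurableT i1 (iqT N)) => w _; rewrite lerDr sqr_ge0.
Qed.

(** Both sides are continuous in f and g for the L2 norm, so that the identity
    passes from the truncations of f and g to f and g themselves. *)
Lemma parseval_crosscorr f g F G tau : L2 f -> L2 g ->
  is_fourier f F -> is_fourier g G ->
  2 * pi * crosscorr f g tau =
  \int[mu]_w rotated_cross (complex.Re (F w)) (complex.Im (F w))
    (complex.Re (G w)) (complex.Im (G w)) w tau.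
Proof.
move=> fL2 gL2 fF gG; have sf := L2_sqint fL2; have sg := L2_sqint gL2.
have [sa sb ca cb] := is_fourier_cvg fL2 fF.
have [sc sd cc cd] := is_fourier_cvg gL2 gG.
pose a w := complex.Re (F w); pose b w := complex.Im (F w).
pose c w := complex.Re (G w); pose d w := complex.Im (G w).
rewrite -/a -/b -/c -/d in sa sb sc sd ca cb cc cd *.
have neg h : sqint mu h -> sqint mu (fun x => - h x).
  by move=> /(sqintZ (-1)); under eq_fun do rewrite mulN1r.
have cL : \int[mu]_w cross_spectrum (trunc f N) (trunc g N) tau w @[N --> \oo]
    --> 2 * pi * crosscorr f g tau.
  rewrite (_ : (fun N => _) =
      (fun N => 2 * pi * crosscorr (trunc f N) (trunc g N) tau)); last first.
    by apply/funext => N; rewrite parseval_L1_L2//;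
      [exact: sqint_trunc|exact: sqint_trunc|exact: integrable_trunc
      |exact: integrable_trunc].
  apply: cvgM; first exact: cvg_cst.
  have sgt := sqint_shift (- tau) sg.
  apply: (@sqint_cvg_mul R _ _ mu (fun N x => trunc f N x)
    (fun N x => trunc g N (x - tau)) f (fun x => g (x - tau))) => //.
  - by move=> N; exact: sqint_trunc.
  - by move=> N; exact: (sqint_shift (- tau) (sqint_trunc N sg)).
  - exact: cvg_trunc.
  - rewrite (_ : (fun N => _) = (fun N =>
      \int[mu]_x ((trunc g N x - g x) ^+ 2))); first exact: cvg_trunc.
    apply/funext => N.
    rewrite -(@Rintegral_shift R (- tau) (fun x => (trunc g N x - g x) ^+ 2))//.
    by apply: measurable_funX; have [] := sqintB (sqint_trunc N sg) sg.
apply/esym; apply: cvg_unique cL => //.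
rewrite (Rintegral_rotated_cross tau sa sb sc sd).2.
have ST h N : sqint mu h -> sqint mu (cosT (trunc h N)) /\
    sqint mu (fun w => - sinT (trunc h N) w).
  move=> sh; have [? /neg ?] :=
    sqint_cosT_sinT (sqint_trunc N sh) (integrable_trunc N sh).
  by split.
have [mc ms] := (@measurable_cosMr R tau, @measurable_sinMr R tau).
have kc w : `|cos (w * tau)| <= 1 :> R by exact: norm_cos_le1.
have ks w : `|sin (w * tau)| <= 1 :> R by exact: norm_sin_le1.
have s1 N := (ST f N sf).1; have s2 N := (ST f N sf).2.
have s3 N := (ST g N sg).1; have s4 N := (ST g N sg).2.
rewrite (funext (fun N =>
  (Rintegral_rotated_cross tau (s1 N) (s2 N) (s3 N) (s4 N)).2)).
apply: cvgD; first apply: cvgB; first apply: cvgD.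
- exact: (sqint_cvg_mul_bounded mc kc s1 s3 sa sc ca cc).
- exact: (sqint_cvg_mul_bounded mc kc s2 s4 sb sd cb cd).
- exact: (sqint_cvg_mul_bounded ms ks s2 s3 sb sc cb cc).
- exact: (sqint_cvg_mul_bounded ms ks s1 s4 sa sd ca cd).
Qed.

End parseval_L2.


(** * Cross-correlations of the dual functions *)

Section dual_crosscorr.
Context {R : realType}.
Notation mu := (@lebesgue_measure R).
Implicit Types (f g : R -> R) (F G : R -> R[i]) (tau w : R) (d : int).

Let twopi_neq0 : 2 * pi != 0 :> R.
Proof. by rewrite mulf_neq0// gt_eqF// pi_gt0. Qed.

Let hilbert_factor w : R[i] := (0 -i* Num.sg w)%C.

Let ReM_hilbert w (z : R[i]) :
  complex.Re (hilbert_factor w * z) = Num.sg w * complex.Im z.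
Proof. by case: z => a b /=; rewrite mul0r sub0r mulNr opprK. Qed.

Let ImM_hilbert w (z : R[i]) :
  complex.Im (hilbert_factor w * z) = - (Num.sg w * complex.Re z).
Proof. by case: z => a b /=; rewrite mul0r add0r mulNr. Qed.

(** The two factors - i sign (w) enter the integrand as the product of
    one with the conjugate of the other, that is, as sign (w) ^ 2. *)
Lemma crosscorr_hilbert2 f g fH gH F G tau :
  L2 f -> L2 g -> L2 fH -> L2 gH -> is_fourier f F -> is_fourier g G ->
  is_fourier fH (fun w => (0 -i* Num.sg w)%C * F w) ->
  is_fourier gH (fun w => (0 -i* Num.sg w)%C * G w) ->
  crosscorr fH gH tau = crosscorr f g tau.
Proof.
move=> f2 g2 fH2 gH2 fF gG fHF gHG; apply: (mulfI twopi_neq0).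
have [sa sb _ _] := is_fourier_cvg f2 fF; have [sc sd _ _] := is_fourier_cvg g2 gG.
have [sa' sb' _ _] := is_fourier_cvg fH2 fHF.
have [sc' sd' _ _] := is_fourier_cvg gH2 gHG.
rewrite (parseval_crosscorr tau fH2 gH2 fHF gHG).
rewrite (parseval_crosscorr tau f2 g2 fF gG).
have [/(measurable_int _) m1 _] := Rintegral_rotated_cross tau sa sb sc sd.
have [/(measurable_int _) m2 _] := Rintegral_rotated_cross tau sa' sb' sc' sd'.
rewrite /Rintegral; congr fine; apply: ae_eq_integral => //.
(* the sign vanishes at the single frequency 0 *)
exists [set 0]; split; [exact: measurable_set1|exact: lebesgue_measure_set1|].
move=> w /= neq; apply: contrapT => w0; apply: neq => _; congr EFin.
rewrite -!/(hilbert_factor w) !ReM_hilbert !ImM_hilbert.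
have sg1 : Num.sg w ^+ 2 = 1 by rewrite sqr_sg; move/eqP: w0 => ->.
by rewrite -[RHS]mul1r -sg1 /rotated_cross; ring.
Qed.

(** Put [z = F w * conj (G w) * exp (i w tau)]. The integrands of the two
    cross-correlations are the real parts of [i sign (w) z] and of
    [i sign (w) conj z = - conj (i sign (w) z)], which are opposite. *)
Lemma crosscorr_hilbert f g fH gH F G tau :
  L2 f -> L2 g -> L2 fH -> L2 gH -> is_fourier f F -> is_fourier g G ->
  is_fourier fH (fun w => (0 -i* Num.sg w)%C * F w) ->
  is_fourier gH (fun w => (0 -i* Num.sg w)%C * G w) ->
  crosscorr f gH tau = - crosscorr g fH (- tau).
Proof.
move=> f2 g2 fH2 gH2 fF gG fHF gHG; apply: (mulfI twopi_neq0).
rewrite mulrN (parseval_crosscorr tau f2 gH2 fF gHG).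
rewrite (parseval_crosscorr (- tau) g2 fH2 gG fHF).
have [sa sb _ _] := is_fourier_cvg fH2 fHF; have [sc sd _ _] := is_fourier_cvg g2 gG.
have [i1 _] := Rintegral_rotated_cross (- tau) sc sd sa sb.
rewrite -mulN1r -RintegralZl//; apply: eq_Rintegral => w _.
rewrite -!/(hilbert_factor w) !ReM_hilbert !ImM_hilbert.
by rewrite /rotated_cross (mulrN w tau) cosN sinN; ring.
Qed.

Let exprz_N1 (k : int) : ((-1) ^ k = 1 :> R[i]) \/ ((-1) ^ k = -1 :> R[i]).
Proof.
have pow n : ((-1) ^+ n = 1 :> R[i]) \/ ((-1) ^+ n = -1 :> R[i]).
  by rewrite -signr_odd; case: odd; [right|left].
case: k => n; first exact: pow.
by rewrite NegzE -exprnN; have [->|->] := pow n.+1; rewrite ?invr1 ?invrN1; [left|right].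
Qed.

Let dual_phaseE d w : exists s : R, s ^+ 2 = 1 /\
  let th := (d%:~R + 1 / 2) * w in
  dual_phase d w = ((s * cos th) -i* (s * sin th))%C.
Proof.
rewrite /dual_phase /cexp.
set k := Num.floor _; set th := (_ * w).
have : exists s : R, s ^+ 2 = 1 /\
    (if (0 <= k)%R then (-1) ^ k else (-1) ^ (k + 1)) = (s +i* 0)%C.
  case: ifP => _; [have [->|->] := exprz_N1 k|have [->|->] := exprz_N1 (k + 1)].
  - by exists 1; rewrite expr1n.
  - by exists (-1); rewrite sqrrN expr1n; split => //; congr Complex; rewrite ?oppr0.
  - by exists 1; rewrite expr1n.
  - by exists (-1); rewrite sqrrN expr1n; split => //; congr Complex; rewrite ?oppr0.
move=> [s [s1 ->]]; exists s; split => //=.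
rewrite cosN sinN; congr Complex; ring.
Qed.

(** The phase has modulus 1. *)
Lemma crosscorr_dual_phase2 d f fH F tau : L2 f -> L2 fH -> is_fourier f F ->
  is_fourier fH (fun w => dual_phase d w * F w) ->
  crosscorr fH fH tau = crosscorr f f tau.
Proof.
move=> f2 fH2 fF fHF; apply: (mulfI twopi_neq0).
rewrite (parseval_crosscorr tau fH2 fH2 fHF fHF).
rewrite (parseval_crosscorr tau f2 f2 fF fF).
apply: eq_Rintegral => w _; have [s [s1 ->]] := dual_phaseE d w.
set th := (_ * w); case: (F w) => a b /=.
have cs : (s * cos th) ^+ 2 + (s * sin th) ^+ 2 = 1.
  by rewrite !exprMn s1 !mul1r cos2Dsin2.
by rewrite -[RHS]mul1r -cs /rotated_cross; ring.
Qed.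

(** Up to a sign that depends on w only, the integrand is
    [`|F w| ^+ 2 * cos (w * (tau + d + 1/2))], which is even in
    [tau + d + 1/2]. *)
Lemma crosscorr_dual_phase_sym d f fH F tau : L2 f -> L2 fH -> is_fourier f F ->
  is_fourier fH (fun w => dual_phase d w * F w) ->
  crosscorr f fH tau = crosscorr f fH (- tau - 2 * d%:~R - 1).
Proof.
move=> f2 fH2 fF fHF; apply: (mulfI twopi_neq0).
rewrite !(parseval_crosscorr _ f2 fH2 fF fHF).
apply: eq_Rintegral => w _; have [s [s1 ->]] := dual_phaseE d w.
set th := (_ * w); case: (F w) => a b /=.
have key t : rotated_cross a b (s * cos th * a - - (s * sin th) * b)
    (s * cos th * b + - (s * sin th) * a) w t =
    s * (a ^+ 2 + b ^+ 2) * cos (w * t + th).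
  by rewrite cosD /rotated_cross; ring.
rewrite !key -[in RHS]cosN; congr (_ * cos _); rewrite /th.
by field.
Qed.

End dual_crosscorr.


(** * Covariances of the coefficients *)

Section product_sigma_finite.
Context {R : realType} {d1 d2 : measure_display}.
Context {T1 : measurableType d1} {T2 : measurableType d2}.
Variable m1 : {sigma_finite_measure set T1 -> \bar R}.
Variable m2 : {sigma_finite_measure set T2 -> \bar R}.

Lemma sigma_finite_product : sigma_finite setT (m1 \x m2)%E.
Proof.
have /sigma_finiteP[A [AT ndA Afin]] := sigma_finiteT m1.
have /sigma_finiteP[B [BT ndB Bfin]] := sigma_finiteT m2.
exists (fun k => A k `*` B k) => [|k].
  apply/esym; rewrite -subTset => -[x y] _.
  have [i _ Aix] : (\bigcup_i A i) x by rewrite -AT.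
  have [k _ Bky] : (\bigcup_i B i) y by rewrite -BT.
  exists (maxn i k) => //; split => /=.
    by move/subsetPset : (ndA i (maxn i k) (leq_maxl _ _)); exact.
  by move/subsetPset : (ndB k (maxn i k) (leq_maxr _ _)); exact.
have [mA Ak] := Afin k; have [mB Bk] := Bfin k; split; first exact: measurableX.
by rewrite product_measure1E// lte_mul_pinfty// ge0_fin_numE.
Qed.

(** The product as a sigma-finite measure, which can serve as a factor of
    another product. *)
Definition sigma_finite_prod : {sigma_finite_measure set (T1 * T2)%type -> \bar R} :=
  HB.pack (m1 \x m2)%E
    (Measure_isSigmaFinite.Build _ _ _ (m1 \x m2)%E sigma_finite_product).

End product_sigma_finite.

Section dilation.
Context {R : realType}.
Notation mu := (@lebesgue_measure R).
Implicit Types (f g : R -> R) (s : R).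

Variables (M : nat) (j : int).
Hypothesis M_gt0 : (0 < M)%N.

Let a : R := (M%:R : R) ^ (- j).

Let a_gt0 : 0 < a.
Proof. by rewrite exprz_gt0// ltr0n. Qed.

Lemma sqint_affine k f : sqint mu f -> sqint mu (fun x => f (a * x - k)).
Proof.
move=> [mf f2]; split; last exact: (integrable_affine (- k) (lt0r_neq0 a_gt0) f2).
apply: (measurableT_comp mf).
by apply: measurable_funB => //; exact: measurable_funM.
Qed.

Lemma sqint_dilate (k : int) f : sqint mu f -> sqint mu (dilate M j k f).
Proof. by move=> sf; apply: sqintZ; exact: sqint_affine. Qed.

(** The factors [M ^ (- j / 2)] make the dilations unitary, so that no factor
    is left. *)
Lemma crosscorr_dilate (k l : int) f g s : sqint mu f -> sqint mu g ->
  crosscorr (dilate M j (k + l) f) (dilate M j k g) s =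
  crosscorr f g (a * s - l%:~R).
Proof.
move=> sf sg; pose c : R := M%:R `^ (- (j%:~R / 2)).
have c2 : c * c = a.
  rewrite /c -powRD; last by rewrite pnatr_eq0 -lt0n M_gt0 implybT.
  by rewrite /a -(powR_intmul _ (ler0n R M)) rmorphN/=; congr (_ `^ _); field.
have a0 := lt0r_neq0 a_gt0.
pose h y := f y * g (y - (a * s - l%:~R)).
have ih : mu.-integrable setT (EFin \o h).
  exact: (sqint_mul_integrable sf (sqint_shift (- (a * s - l%:~R)) sg)).
have iha := integrable_affine (- (k + l)%:~R) a0 ih.
transitivity (\int[mu]_x (a * h (a * x + - (k + l)%:~R))).
  apply: eq_Rintegral => x _; rewrite /dilate -/a -/c /h mulrACA c2 rmorphD/=.
  have -> : a * x - (k%:~R + l%:~R) - (a * s - l%:~R) = a * (x - s) - k%:~R.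
    by ring.
  by [].
rewrite RintegralZl// (Rintegral_affine _ a0 ih) gtr0_norm//.
by rewrite mulrA divff// mul1r.
Qed.

End dilation.

Section covariance.
Context {R : realType} {disp : measure_display} {T : measurableType disp}.
Notation mu := (@lebesgue_measure R).
Variable P : probability T R.
Variable n : R -> {RV P >-> R}.
Hypothesis mn : jointly_measurable n.
Hypothesis n_L2 : forall x, (n x : T -> R) \in Lfun P 2%:E.
Implicit Types u v : R -> R.

Let mu2 := sigma_finite_prod mu mu.

(** Its integral over the plane is the product of the integrals of [n u] and
    [n v] along a sample path, and its expectation involves the
    autocovariance of n. *)
Definition sample_product u v (z : T * (measurableTypeR R * measurableTypeR R)) : R :=
  n z.2.1 z.1 * n z.2.2 z.1 * (u z.2.1 * v z.2.2).

Let measurable_sample_product u v : measurable_fun setT u -> measurable_fun setT v ->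
  measurable_fun setT (sample_product u v).
Proof.
move=> mu' mv; apply: measurable_funM.
  apply: measurable_funM.
    apply: (measurableT_comp (f := fun z : measurableTypeR R * T => n z.1 z.2)
      (g := fun z : T * (measurableTypeR R * measurableTypeR R) => (z.2.1, z.1))) => //.
    apply: measurable_fun_pair => //.
    by apply: measurableT_comp.
  apply: (measurableT_comp (f := fun z : measurableTypeR R * T => n z.1 z.2)
    (g := fun z : T * (measurableTypeR R * measurableTypeR R) => (z.2.2, z.1))) => //.
  apply: measurable_fun_pair => //.
  by apply: measurableT_comp.
apply: measurable_funM.
  apply: (measurableT_comp mu'); exact: measurableT_comp.
apply: (measurableT_comp mv); exact: measurableT_comp.
Qed.

(** The integrability that Fubini's theorem needs on the product of the
    probability space and the plane. *)
Definition absolutely_covariant u v : Prop :=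
  (P \x mu2)%E.-integrable setT (EFin \o sample_product u v).

Lemma absolutely_covariantP u v : measurable_fun setT u -> measurable_fun setT v ->
  (\int[mu]_x \int[mu]_y
    ('E_P[fun t => `|n x t * n y t|%R] * `|u x|%:E * `|v y|%:E) < +oo)%E ->
  absolutely_covariant u v.
Proof.
move=> mu' mv acuv.
have mP := measurable_sample_product mu' mv.
have mPE : measurable_fun setT (EFin \o sample_product u v) by exact/measurable_EFinP.
have mPa : measurable_fun setT (abse \o (EFin \o sample_product u v)).
  exact: measurableT_comp.
apply/integrable21ltyP => //.
have -> : (\int[mu2]_z \int[P]_t `|(EFin \o sample_product u v) (t, z)| =
    \int[mu]_x \int[mu]_y \int[P]_t `|(EFin \o sample_product u v) (t, (x, y))|)%E.
  rewrite -(fubini_tonelli1 (m1 := mu) (m2 := mu)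
    (fun z => \int[P]_t `|(EFin \o sample_product u v) (t, z)|)%E)//.
    apply: (measurable_fun_fubini_tonelli_G (abse \o (EFin \o sample_product u v))) => //.
    by move=> z; exact: abse_ge0.
  by move=> z; exact: integral_ge0.
move: acuv; apply: le_lt_trans; rewrite le_eqVlt; apply/orP; left; apply/eqP.
apply: eq_integral => x _; apply: eq_integral => y _.
have mnn : measurable_fun setT (fun t => (`|n x t * n y t|)%:E).
  apply/measurable_EFinP; apply: measurableT_comp => //.
  exact: measurable_funM.
rewrite unlock /= -ge0_integralZr//.
rewrite -ge0_integralZr//.
  by apply: eq_integral => t _; rewrite /sample_product/= -!EFinM !normrM !mulrA.
exact: emeasurable_funM.
Qed.

Lemma absolutely_covariantZ c u v : absolutely_covariant u v ->
  absolutely_covariant (fun x => c * u x) (fun x => c * v x).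
Proof.
move=> /(integrableZl measurableT (c ^+ 2)); apply: eq_integrable => // z _ /=.
by congr EFin; rewrite /sample_product; ring.
Qed.

(** Along almost every path, the double integral is finite; with u = v it is the
    square of the integral of [`|n x t * u x|]. *)
Let ae_integrable_mul u : measurable_fun setT u -> absolutely_covariant u u ->
  {ae P, forall t, mu.-integrable setT (EFin \o (fun x => n x t * u x))}.
Proof.
move=> mu' ac; have := ae_integrable1 ac; apply: filterS => t it.
have mnu : measurable_fun setT (fun x => n x t * u x).
  apply: measurable_funM => //.
  apply: (measurableT_comp (f := fun z : measurableTypeR R * T => n z.1 z.2)
    (g := fun x : measurableTypeR R => (x, t))) => //.
apply/integrableP; split; first exact/measurable_EFinP.
have mabs : measurable_fun setT (fun x => `|(n x t * u x)%:E|)%E.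
  by apply: measurableT_comp => //; exact/measurable_EFinP.
set I := (\int[mu]_x _)%E.
have I0 : (0 <= I)%E by exact: integral_ge0.
have : (I * I < +oo)%E.
  have /integrableP[mit] := it.
  rewrite [X in (X < _)%E](_ : _ = (I * I)%E)//.
  transitivity (\int[mu]_x \int[mu]_y `|(EFin \o sample_product u u) (t, (x, y))|)%E.
    apply: (fubini_tonelli1 (m1 := mu) (m2 := mu)
      (fun z => `|(EFin \o sample_product u u) (t, z)|)%E).
      by apply: measurableT_comp => //; exact: mit.
    by move=> z; exact: abse_ge0.
  rewrite {2}/I -ge0_integralZr//.
  apply: eq_integral => x _; rewrite /I -ge0_integralZl//.
  apply: eq_integral => y _; rewrite -EFinM /sample_product/= -normrM.
  by congr (`| _ |%:E); ring.
by clearbody I; case: I I0 => [r _ _|_|//]; [exact: ltry|rewrite mulyy].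
Qed.

Variable Gamma : R -> R.
Hypothesis hGamma : forall tau x,
  ('E_P[fun t => (n (x + tau)%R t * n x t)%R] = (Gamma tau)%:E)%E.

Lemma autocovariance_even tau : Gamma (- tau) = Gamma tau.
Proof.
apply: EFin_inj; rewrite -(hGamma (- tau) tau) subrr -(hGamma tau 0) add0r.
by congr expectation; apply/funext => t; rewrite mulrC.
Qed.

Lemma measurable_autocovariance : measurable_fun setT Gamma.
Proof.
rewrite (_ : Gamma = fun tau => \int[P]_t (n tau t * n 0 t)); last first.
  by apply/funext => tau; have := hGamma tau 0; rewrite add0r unlock /Rintegral => ->.
apply: (@measurable_Rintegral R _ _ _ _ P
  (fun z : measurableTypeR R * T => n z.1 z.2 * n 0 z.2)).
by apply: measurable_funM; [exact: mn|exact: measurableT_comp].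
Qed.

(** Exchange the expectation with the integral over the plane, and apply
    [Rintegral_conv_crosscorr] to the autocovariance. *)
Lemma expectation_mul_integrals u v : sqint mu u -> sqint mu v ->
  absolutely_covariant u u -> absolutely_covariant v v ->
  absolutely_covariant u v ->
  mu.-integrable setT (EFin \o (fun s => Gamma s * crosscorr u v s)) /\
  ('E_P[fun t => ((\int[mu]_x (n x t * u x)) * (\int[mu]_x (n x t * v x)))%R] =
   (\int[mu]_s (Gamma s * crosscorr u v s))%:E)%E.
Proof.
move=> su sv acu acv acuv; have [mu' _] := su; have [mv _] := sv.
have [iP1 eP1] := Rintegral12 acuv; have [iP2 eP2] := Rintegral21 acuv.
have GammaE x y : \int[P]_t (n x t * n y t) = Gamma (x - y).
  rewrite /Rintegral; have := hGamma (x - y) y; rewrite addrC subrK unlock.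
  by move=> ->.
have inn x y : P.-integrable setT (EFin \o (fun t => n x t * n y t)).
  by apply/Lfun1_integrable/Lfun2_mul_Lfun1.
have innerE z : \int[P]_t sample_product u v (t, z) =
    Gamma (z.1 - z.2) * (u z.1 * v z.2).
  by rewrite -GammaE -RintegralZr.
have iK : (mu \x mu)%E.-integrable setT
    (EFin \o (fun z : measurableTypeR R * measurableTypeR R =>
      Gamma (z.1 - z.2) * (u z.1 * v z.2))).
  by apply: eq_integrable iP2 => // z _ /=; rewrite innerE.
have [iG eG] := Rintegral_conv_crosscorr measurable_autocovariance su sv iK.
split => //; rewrite -eG.
have aeE : {ae P, forall t, setT t ->
    \int[mu2]_z sample_product u v (t, z) =
    (\int[mu]_x (n x t * u x)) * (\int[mu]_x (n x t * v x))}.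
  have iu := ae_integrable_mul mu' acu; have iv := ae_integrable_mul mv acv.
  apply: filterS2 iu iv => t iu iv _.
  rewrite -(Rintegral_prodM iu iv).
  by apply: eq_Rintegral => z _; rewrite /sample_product/=; ring.
have mI w : measurable_fun setT w ->
    measurable_fun setT (fun t => \int[mu]_x (n x t * w x)).
  move=> mw; apply: (@measurable_Rintegral R _ _ _ _ mu
    (fun z : T * measurableTypeR R => n z.2 z.1 * w z.2)).
  apply: measurable_funM; last exact: measurableT_comp.
  apply: (measurableT_comp (f := fun z : measurableTypeR R * T => n z.1 z.2)
    (g := fun z : T * measurableTypeR R => (z.2, z.1))) => //.
  exact: measurable_fun_pair.
rewrite unlock; transitivity (\int[P]_t (\int[mu2]_z sample_product u v (t, z))%:E)%E.
  apply: ae_eq_integral => //.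
  - by apply/measurable_EFinP; apply: measurable_funM; exact: mI.
  - exact: measurable_int iP1.
  - by apply: filterS aeE => t e /e ->.
rewrite -[LHS]fineK; last exact: (integrable_fin_num measurableT iP1).
rewrite -[X in X%:E]/(\int[P]_t \int[mu2]_z sample_product u v (t, z)) eP1 -eP2.
by congr EFin; apply: eq_Rintegral => z _ /=; rewrite innerE.
Qed.

End covariance.

Theorem proposition2 (R : realType) (disp : measure_display)
    (T : measurableType disp) (P : probability T R)
    (M : nat) (hM : (2 <= M)%N) (d : int)
    (psi : nat -> R -> R) (psihat H : nat -> R -> complex R)
    (psiH : nat -> R -> R)
    (hpsi : mband_mra M psi psihat H)
    (hpsiH : dual_mra M d psi psihat psiH)
    (j : int) (n : R -> {RV P >-> R})
    (hn0 : zero_mean n) (hn : wide_sense_stationary n)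
    (hF : fubini_condition n M j (tree_functions M psi psiH)) :
  (* (i) *)
  (forall m m' : nat, (m < M)%N -> (m' < M)%N ->
     (m = 0%N /\ m' = 0%N) \/ (m * m')%N <> 0%N ->
     (forall tau : R,
        crosscorr (psiH m) (psiH m') tau = crosscorr (psi m) (psi m') tau) /\
     (forall l k k' : int,
        xcov P (coef n M (psi m) j) (coef n M (psi m') j) k l
        = xcov P (coef n M (psiH m) j) (coef n M (psiH m') j) k' l)) /\
  (* (ii) *)
  (forall m m' : nat, (m < M)%N -> (m' < M)%N -> (m * m')%N <> 0%N ->
     (forall tau : R,
        crosscorr (psi m) (psiH m') tau
        = - crosscorr (psi m') (psiH m) (- tau)) /\
     (forall l k k' : int,
        xcov P (coef n M (psi m) j) (coef n M (psiH m') j) k l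
        = (- xcov P (coef n M (psi m') j) (coef n M (psiH m) j) k' (- l)%R)%E))
  /\
  (* (iii) *)
  ((forall tau : R,
      crosscorr (psi 0%N) (psiH 0%N) tau
      = crosscorr (psi 0%N) (psiH 0%N) (- tau - 2 * d%:~R - 1)) /\
   (forall l k k' : int,
      xcov P (coef n M (psi 0%N) j) (coef n M (psiH 0%N) j) k l
      = xcov P (coef n M (psi 0%N) j) (coef n M (psiH 0%N) j) k'
          (2 * d + 1 - l))).
Proof.
have M0 : (0 < M)%N by exact: leq_trans hM.
case: hn => n_L2 _ [Gamma hG]; case: hF => mn hfub.
pose a : R := (M%:R : R) ^ (- j).
pose S := tree_functions M psi psiH.
have S_sqint f : S f -> sqint lebesgue_measure f.
  move=> [m mM [->|->]]; apply: L2_sqint.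
    exact: (mra_L2 hpsi).
  exact: (dual_L2 hpsiH).
have Spsi m : (m < M)%N -> S (psi m) by move=> mM; exists m => //; left.
have SpsiH m : (m < M)%N -> S (psiH m) by move=> mM; exists m => //; right.
have ac f g (k k' : int) : S f -> S g ->
    absolutely_covariant n (dilate M j k f) (dilate M j k' g).
  move=> Sf Sg; apply: absolutely_covariantZ.
  have [mf _] := sqint_affine j M0 k%:~R (S_sqint _ Sf).
  have [mg _] := sqint_affine j M0 k'%:~R (S_sqint _ Sg).
  by apply: absolutely_covariantP => //; exact: hfub.
(* The dilations turn the cross-correlation into [crosscorr f g (M ^ (- j) s - l)],
   from which k has disappeared. *)
have cov f g (k l : int) : S f -> S g ->
    lebesgue_measure.-integrable setT
      (EFin \o (fun s => Gamma s * crosscorr f g (a * s - l%:~R))) /\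
    xcov P (coef n M f j) (coef n M g j) k l =
    (\int[lebesgue_measure]_s (Gamma s * crosscorr f g (a * s - l%:~R)))%:E.
  move=> Sf Sg; have sf := S_sqint _ Sf; have sg := S_sqint _ Sg.
  have [iG eG] := expectation_mul_integrals mn n_L2 hG
    (sqint_dilate j M0 (k + l) sf) (sqint_dilate j M0 k sg)
    (ac _ _ _ _ Sf Sf) (ac _ _ _ _ Sg Sg) (ac _ _ _ _ Sf Sg).
  have cE : (fun s => Gamma s * crosscorr (dilate M j (k + l) f)
      (dilate M j k g) s) =
      (fun s => Gamma s * crosscorr f g (a * s - l%:~R)).
    by apply/funext => s; rewrite crosscorr_dilate.
  by rewrite cE in iG eG.
(* The change of variable [s -> - s] leaves Gamma invariant. *)
have cov_reflect f g f' g' (c : R) (l l' k k' : int) : S f -> S g -> S f' -> S g' ->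
    (forall s, crosscorr f g (a * s - l%:~R) =
      c * crosscorr f' g' (a * - s - l'%:~R)) ->
    xcov P (coef n M f j) (coef n M g j) k l =
    (c%:E * xcov P (coef n M f' j) (coef n M g' j) k' l')%E.
  move=> Sf Sg Sf' Sg' fg.
  have [_ ->] := cov f g k l Sf Sg; have [i' ->] := cov f' g' k' l' Sf' Sg'.
  have ic := integrableZl measurableT c i'.
  rewrite -EFinM -RintegralZl//.
  rewrite -(@Rintegral_opp R (fun s => c * (Gamma s *
    crosscorr f' g' (a * s - l'%:~R)))).
    congr EFin; apply: eq_Rintegral => s _.
    by rewrite fg (autocovariance_even hG) mulrCA.
  by apply/measurable_EFinP; exact: measurable_int ic.
have psi_L2 m (mM : (m < M)%N) := mra_L2 hpsi mM.
have psi_F m (mM : (m < M)%N) := mra_fourier hpsi mM.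
have psiH_L2 m (mM : (m < M)%N) := dual_L2 hpsiH mM.
have psiH_F m : (m < M)%N -> m <> 0%N ->
    is_fourier (psiH m) (fun w => (0 -i* Num.sg w)%C * psihat m w).
  by move=> mM /eqP m0; apply: (dual_wavelet hpsiH); rewrite lt0n m0.
have nz m m' : (m * m')%N <> 0%N -> m <> 0%N /\ m' <> 0%N.
  by move=> mm'; split => m0; apply: mm'; rewrite m0 ?muln0.
split; [|split].
- move=> m m' mM m'M hm.
  have eqcc tau : crosscorr (psiH m) (psiH m') tau = crosscorr (psi m) (psi m') tau.
    case: hm => [[-> ->]|/nz[m0 m'0]].
      exact: crosscorr_dual_phase2 (psi_L2 _ M0) (psiH_L2 _ M0) (psi_F _ M0)
        (dual_scaling hpsiH).
    exact: crosscorr_hilbert2 (psi_L2 _ mM) (psi_L2 _ m'M) (psiH_L2 _ mM)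
      (psiH_L2 _ m'M) (psi_F _ mM) (psi_F _ m'M) (psiH_F _ mM m0) (psiH_F _ m'M m'0).
  split => // l k k'.
  have [_ ->] := cov _ _ k l (Spsi _ mM) (Spsi _ m'M).
  have [_ ->] := cov _ _ k' l (SpsiH _ mM) (SpsiH _ m'M).
  by congr EFin; apply: eq_Rintegral => s _; rewrite eqcc.
- move=> m m' mM m'M /nz[m0 m'0].
  have eqcc tau : crosscorr (psi m) (psiH m') tau =
      - crosscorr (psi m') (psiH m) (- tau).
    exact: crosscorr_hilbert (psi_L2 _ mM) (psi_L2 _ m'M) (psiH_L2 _ mM)
      (psiH_L2 _ m'M) (psi_F _ mM) (psi_F _ m'M) (psiH_F _ mM m0) (psiH_F _ m'M m'0).
  split => // l k k'.
  rewrite (cov_reflect _ _ (psi m') (psiH m) (-1) l (- l) k k') ?mulN1e//.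
  + exact: Spsi.
  + exact: SpsiH.
  + exact: Spsi.
  + exact: SpsiH.
  + by move=> s; rewrite eqcc mulN1r rmorphN/=; congr (- crosscorr _ _ _); ring.
- have eqcc tau : crosscorr (psi 0%N) (psiH 0%N) tau =
      crosscorr (psi 0%N) (psiH 0%N) (- tau - 2 * d%:~R - 1).
    exact: crosscorr_dual_phase_sym (psi_L2 _ M0) (psiH_L2 _ M0) (psi_F _ M0)
      (dual_scaling hpsiH).
  split => // l k k'.
  rewrite (cov_reflect _ _ (psi 0%N) (psiH 0%N) 1 l (2 * d + 1 - l) k k') ?mul1e//.
  + exact: Spsi.
  + exact: SpsiH.
  + exact: Spsi.
  + exact: SpsiH.
  + move=> s; rewrite eqcc mul1r; congr (crosscorr _ _ _).
    by rewrite rmorphB rmorphD rmorphM/=; ring.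
Qed.
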